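(* Let $Z_{\epsilon,\lambda}$ denote the regularized vector field $$Z_{\epsilon,\lambda}(z)=\phi(h_\lambda(z)\epsilon^{-1})Z_\lambda^+(z)+(1-\phi(h_\lambda(z)\epsilon^{-1}))Z_\lambda^-(z),$$ and let $m_\lambda\subset\Sigma_\lambda^{sl}$ be a bounded segment not containing pseudo-equilibria. Let $I(m_\lambda)$ be the slow divergence integral of $Z_{\epsilon,\lambda}$ along $m_\lambda$. The following statements are true. 1. Let $T:V_w\to V_z\subset V$ ($w\mapsto z=T(w)$) be a smooth coordinate transformation, with open sets $V_w,V_z\subset\mathbb R^2$, and suppose $m_\lambda\subset V_z$. Then the slow divergence integral $I(T^{-1}(m_\lambda))$ of the pullback of the vector field $Z_{\epsilon,\lambda}|_{V_z}$ along $T^{-1}(m_\lambda)\subset V_w$ is equal to $I(m_\lambda)$. 2. Let $g$ be a smooth strictly positive function defined in a neighborhood of $m_\lambda$. Then the slow divergence integral of $Z_{\epsilon,\lambda}$ along $m_\lambda$ is equal to the slow divergence integral of the equivalent vector field $g\cdot Z_{\epsilon,\lambda}$ along $m_\lambda$. 3. Let $p_\lambda:[v_1,v_2]\to\mathbb R^2$ be a parameterization of $m_\lambda$. Then $$I(m_\lambda)=\int_{v_1}^{v_2}\frac{E_\lambda(p_\lambda(v))\,dv}{|\tilde p_\lambda(v)|},$$ where $\tilde p_\lambda$ is a smooth $\lambda$-family of nowhere zero functions satisfying $Z_\lambda^{sl}(p_\lambda(v))=\tilde p_\lambda(v)\,p_\lambda'(v)$.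
   Context: Smooth means $C^\infty$. PWS system. Let $\lambda\sim\lambda_0\in\mathbb R^l$ (i.e. $\lambda$ in a neighborhood of $\lambda_0$), $V\subset\mathbb R^2$ open, and $h_\lambda$ a smooth family of functions. The switching boundary is $\Sigma_\lambda=\{z\in\mathbb R^2 : h_\lambda(z)=0\}\cap V$, and $\nabla h_\lambda(z)\neq(0,0)$ for all $z\in\Sigma_\lambda$. Put $\Sigma_\lambda^{\pm}=\{z\in V: \pm h_\lambda(z)>0\}$. The piecewise smooth system is $\dot z=Z_\lambda^+(z)$ for $z\in\Sigma_\lambda^+$ and $\dot z=Z_\lambda^-(z)$ for $z\in\Sigma_\lambda^-$, where $Z_\lambda^{\pm}$ is a $\lambda$-family of vector fields, smooth in the closure of $\Sigma_\lambda^{\pm}$. Sliding. Write $Z_\lambda^\pm(h_\lambda)(z)=\nabla h_\lambda(z)\cdot Z_\lambda^\pm(z)$ (Lie derivative) and $(Z_\lambda^+-Z_\lambda^-)(h_\lambda)=Z_\lambda^+(h_\lambda)-Z_\lambda^-(h_\lambda)$. The sliding set is $\Sigma_\lambda^{sl}=\{z\in\Sigma_\lambda : Z_\lambda^+(h_\lambda)(z)\,Z_\lambda^-(h_\lambda)(z)<0\}$. On $\Sigma_\lambda^{sl}$ the Filippov sliding vector field is $$Z_\lambda^{sl}(z)=\frac{1}{(Z_\lambda^+-Z_\lambda^-)(h_\lambda)}\left(Z_\lambda^+(h_\lambda)Z_\lambda^--Z_\lambda^-(h_\lambda)Z_\lambda^+\right)(z),$$ and $\tau_\lambda(z)=\frac{-Z_\lambda^-(h_\lambda)}{(Z_\lambda^+-Z_\lambda^-)(h_\lambda)}(z)\in\,]0,1[$.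 A point $z\in\Sigma_\lambda^{sl}$ is a pseudo-equilibrium if $Z_\lambda^{sl}(z)=0$. Regularization. $0<\epsilon\ll1$, and $\phi:\mathbb R\to\mathbb R$ is smooth with $\phi'(u)>0$ for all $u$, $\phi(u)\to1$ as $u\to\infty$, $\phi(u)\to0$ as $u\to-\infty$, and $\phi$ is smooth at $\pm\infty$: the functions $\phi_+$ ($\phi_+(0)=1$, $\phi_+(u)=\phi(u^{-1})$ for $u>0$) and $\phi_-$ ($\phi_-(0)=0$, $\phi_-(u)=\phi(-u^{-1})$ for $u>0$) are smooth at $u=0$. The regularized system is $\dot z=Z_{\epsilon,\lambda}(z)$. Slow divergence integral. Let $m_\lambda\subset\Sigma_\lambda^{sl}$ be a bounded segment not containing pseudo-equilibria, and let $z_\lambda:[t_1,t_2]\to\mathbb R^2$ be a solution of $z'(t)=Z_\lambda^{sl}(z(t))$ parameterizing $m_\lambda$, with $z_\lambda(t_1)$, $z_\lambda(t_2)$ the end points of $m_\lambda$. The slow divergence integral of the regularized system associated to $m_\lambda$ is $$I(m_\lambda)=\int_{t_1}^{t_2}E_\lambda(z_\lambda(t))\,dt,\qquad E_\lambda(z)=(Z_\lambda^+-Z_\lambda^-)(h_\lambda)(z)\,\phi'\left(\phi^{-1}(\tau_\lambda(z))\right),\ z\in\Sigma_\lambda^{sl}.$$ It does not depend on the choice of the solution $z_\lambda$. The pullback is $T^*(Z_{\epsilon,\lambda}|_{V_z})(w)=DT(w)^{-1}Z_{\epsilon,\lambda}(T(w))$; it is regarded as the regularized vector field of the same form with data $h_\lambda\circ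 T$ and $W_\lambda^\pm(w)=DT(w)^{-1}Z_\lambda^\pm(T(w))$ in place of $h_\lambda$ and $Z_\lambda^\pm$. Likewise $g\cdot Z_{\epsilon,\lambda}$ is regarded as the regularized vector field with data $h_\lambda$ and $gZ_\lambda^\pm$. Their slow divergence integrals are given by the definition above applied to these data (same $\phi$). *)

(* Defs.v *)
From HB Require Import structures.
From mathcomp Require Import all_boot all_order all_algebra.
From mathcomp Require Import all_classical all_reals all_analysis.
Set Implicit Arguments.
Unset Strict Implicit.
Unset Printing Implicit Defensive.
Import Order.TTheory GRing.Theory Num.Theory.
Import numFieldNormedType.Exports.
Local Open Scope classical_set_scope.
Local Open Scope ring_scope.

(* [Ck k U f]: f is of class C^k at the points of U. It is meant for an open U
   and for finite-dimensional V, where "f is differentiable and all its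
   directional derivatives are C^k" says that f is C^(k+1). *)
Fixpoint Ck (R : realType) (V W : normedModType R) (k : nat)
    (U : set V) (f : V -> W) : Prop :=
  match k with
  | 0%N => forall x, U x -> {for x, continuous f}
  | k'.+1 => (forall x, U x -> differentiable f x)
             /\ (forall v : V, Ck k' U ('D_v f))
  end.

Definition smooth_on (R : realType) (V W : normedModType R)
    (U : set V) (f : V -> W) : Prop := forall k, Ck k U f.

Definition smooth_near (R : realType) (V W : normedModType R)
    (A : set V) (f : V -> W) : Prop :=
  exists U : set V, [/\ open U, A `<=` U & smooth_on U f].

(* Smoothness of f restricted to a set A that need not be open: only the values
   of f on A matter. *)
Definition smooth_in (R : realType) (V W : normedModType R)
    (A : set V) (f : V -> W) : Prop :=
  exists g : V -> W, smooth_near A g /\ {in A, f =1 g}.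

Definition uncurried (A B C : Type) (f : A -> B -> C) (x : A * B) : C :=
  f x.1 x.2.

Definition gradient (R : realType) (h : 'rV[R]_2 -> R) (z : 'rV[R]_2)
    : 'rV[R]_2 := \row_i 'D_(delta_mx 0 i) h z.

Definition lie (R : realType) (Z : 'rV[R]_2 -> 'rV[R]_2) (h : 'rV[R]_2 -> R)
    (z : 'rV[R]_2) : R := \sum_i gradient h z 0 i * Z z 0 i.

(* The data of a system for one value of the parameter. All functions are total;
   only the values of swh on dom, and those of fldp and fldm on the closures of
   sidep and sidem, are meaningful. *)
Record pws (R : realType) := Pws {
  dom : set 'rV[R]_2;
  swh : 'rV[R]_2 -> R;
  fldp : 'rV[R]_2 -> 'rV[R]_2;
  fldm : 'rV[R]_2 -> 'rV[R]_2
}.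

Section Sliding.
Variables (R : realType) (D : pws R).

Definition switching : set 'rV[R]_2 := [set z | swh D z = 0] `&` dom D.
Definition sidep : set 'rV[R]_2 := [set z | dom D z /\ 0 < swh D z].
Definition sidem : set 'rV[R]_2 := [set z | dom D z /\ 0 < - swh D z].

Definition liep (z : 'rV[R]_2) : R := lie (fldp D) (swh D) z.
Definition liem (z : 'rV[R]_2) : R := lie (fldm D) (swh D) z.

Definition sliding_set : set 'rV[R]_2 :=
  [set z | switching z /\ liep z * liem z < 0].

Definition sliding_field (z : 'rV[R]_2) : 'rV[R]_2 :=
  (liep z - liem z)^-1 *: (liep z *: fldm D z - liem z *: fldp D z).

Definition tau (z : 'rV[R]_2) : R := - liem z / (liep z - liem z).

Definition pseudo_equilibrium (z : 'rV[R]_2) : Prop :=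
  sliding_set z /\ sliding_field z = 0.

(* The derivative at the end points v1, v2 makes sense because the curve is taken
   together with a smooth extension to a neighbourhood of [v1, v2]. *)
Definition regular_param (m : set 'rV[R]_2) (v1 v2 : R) (p : R -> 'rV[R]_2)
    : Prop :=
  [/\ v1 < v2,
      smooth_near `[v1, v2] p,
      {in `[v1, v2] &, injective p},
      (forall v, v \in `[v1, v2] -> derive1 p v != 0)
    & p @` `[v1, v2] = m].

Definition segment (m : set 'rV[R]_2) : Prop :=
  exists v1 v2 p, regular_param m v1 v2 p.

Definition sliding_segment (m : set 'rV[R]_2) : Prop :=
  [/\ segment m, m `<=` sliding_set
    & forall z, m z -> ~ pseudo_equilibrium z].

(* Continuity up to the end points and the equation in the interior amount to the
   equation on [t1, t2] with one-sided derivatives at t1 and t2. *)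
Definition sliding_solution (m : set 'rV[R]_2) (t1 t2 : R) (z : R -> 'rV[R]_2)
    : Prop :=
  [/\ t1 < t2,
      {within `[t1, t2], continuous z},
      (forall t, t \in `]t1, t2[ -> is_derive t 1 z (sliding_field (z t))),
      {in `[t1, t2] &, injective z}
    & z @` `[t1, t2] = m].

End Sliding.

Definition phi_plus (R : realType) (phi : R -> R) (u : R) : R :=
  if u == 0 then 1 else phi u^-1.
Definition phi_minus (R : realType) (phi : R -> R) (u : R) : R :=
  if u == 0 then 0 else phi (- u^-1).

Definition regularizing (R : realType) (phi : R -> R) : Prop :=
  [/\ smooth_on setT phi,
      (forall u, 0 < derive1 phi u),
      phi u @[u --> +oo] --> (1 : R) /\ phi u @[u --> -oo] --> (0 : R),
      smooth_in [set u : R | 0 <= u] (phi_plus phi)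
    & smooth_in [set u : R | 0 <= u] (phi_minus phi)].

Definition regularized (R : realType) (phi : R -> R) (eps : R) (D : pws R)
    (z : 'rV[R]_2) : 'rV[R]_2 :=
  phi (swh D z * eps^-1) *: fldp D z
  + (1 - phi (swh D z * eps^-1)) *: fldm D z.

Definition divergence (R : realType) (phi : R -> R) (D : pws R)
    (z : 'rV[R]_2) : R :=
  (liep D z - liem D z) * derive1 phi (pinv setT phi (tau D z)).

(* The integral is independent of the solution z; [get] picks one value. *)
Definition slow_divergence_integral (R : realType) (phi : R -> R) (D : pws R)
    (m : set 'rV[R]_2) : R :=
  get [set I | exists t1 t2 z, sliding_solution D m t1 t2 z /\
    I = \int[lebesgue_measure]_(t in `[t1, t2]) divergence phi D (z t)].

Definition coordinate_change (R : realType) (Vw Vz : set 'rV[R]_2)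
    (T : 'rV[R]_2 -> 'rV[R]_2) : Prop :=
  [/\ open Vw, open Vz, set_bij Vw Vz T, smooth_on Vw T
    & exists S, smooth_on Vz S /\ {in Vw, cancel T S}].

(* With row vectors DT(w) acts as v |-> v *m 'J T w. *)
Definition pullback_field (R : realType) (T Z : 'rV[R]_2 -> 'rV[R]_2)
    (w : 'rV[R]_2) : 'rV[R]_2 := Z (T w) *m invmx ('J T w).

Definition pullback (R : realType) (Vw : set 'rV[R]_2)
    (T : 'rV[R]_2 -> 'rV[R]_2) (D : pws R) : pws R :=
  Pws Vw (swh D \o T) (pullback_field T (fldp D)) (pullback_field T (fldm D)).

Definition rescale (R : realType) (N : set 'rV[R]_2) (g : 'rV[R]_2 -> R)
    (D : pws R) : pws R :=
  Pws (dom D `&` N) (swh D)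
    (fun z => g z *: fldp D z) (fun z => g z *: fldm D z).

Lemma regularized_pullback (R : realType) (phi : R -> R) (eps : R)
    (Vw : set 'rV[R]_2) (T : 'rV[R]_2 -> 'rV[R]_2) (D : pws R) :
  regularized phi eps (pullback Vw T D)
  = pullback_field T (regularized phi eps D).
Proof.
by apply/funext => w; rewrite /regularized /pullback_field mulmxDl -!scalemxAl.
Qed.

Lemma regularized_rescale (R : realType) (phi : R -> R) (eps : R)
    (N : set 'rV[R]_2) (g : 'rV[R]_2 -> R) (D : pws R) :
  regularized phi eps (rescale N g D)
  = (fun z => g z *: regularized phi eps D z).
Proof.
apply/funext => z; rewrite /regularized /= scalerDr !scalerA.
by rewrite ![g z * _]mulrC.
Qed.

Definition pws_at (R : realType) (l : nat) (V : set 'rV[R]_2)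
    (h : 'rV[R]_l -> 'rV[R]_2 -> R) (Zp Zm : 'rV[R]_l -> 'rV[R]_2 -> 'rV[R]_2)
    (lam : 'rV[R]_l) : pws R := Pws V (h lam) (Zp lam) (Zm lam).

Definition pws_family (R : realType) (l : nat) (Lam : set 'rV[R]_l)
    (V : set 'rV[R]_2) (h : 'rV[R]_l -> 'rV[R]_2 -> R)
    (Zp Zm : 'rV[R]_l -> 'rV[R]_2 -> 'rV[R]_2) : Prop :=
  let D := pws_at V h Zp Zm in
  [/\ open V,
      smooth_on (Lam `*` V) (uncurried h),
      (forall lam, Lam lam ->
        forall z, switching (D lam) z -> gradient (h lam) z != 0),
      smooth_in [set x | Lam x.1 /\ closure (sidep (D x.1)) x.2] (uncurried Zp)
    & smooth_in [set x | Lam x.1 /\ closure (sidem (D x.1)) x.2] (uncurried Zm)].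

Definition speed_family (R : realType) (l : nat) (Lam : set 'rV[R]_l)
    (D : 'rV[R]_l -> pws R) (v1 v2 : R) (p : 'rV[R]_l -> R -> 'rV[R]_2)
    (q : 'rV[R]_l -> R -> R) : Prop :=
  smooth_in (Lam `*` `[v1, v2]) (uncurried q) /\
  forall lam v, Lam lam -> v \in `[v1, v2] ->
    q lam v != 0 /\ sliding_field (D lam) (p lam v) = q lam v *: derive1 (p lam) v.

(* Main.v *)
Require Import Defs.
From HB Require Import structures.
From mathcomp Require Import all_boot all_order all_algebra.
From mathcomp Require Import all_classical all_reals all_analysis.
From mathcomp Require Import measurable_realfun lra.
Set Implicit Arguments.
Unset Strict Implicit.
Unset Printing Implicit Defensive.
Import Order.TTheory GRing.Theory Num.Theory.
Import numFieldNormedType.Exports.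
Local Open Scope classical_set_scope.
Local Open Scope ring_scope.

(** The slow divergence integral is an integral over time along the sliding
    flow, and all three statements follow from one formula that expresses it
    through an arbitrary regular parameterization [p] of the segment.

    At a point of the switching boundary both the sliding field [X] and the
    velocity [p'] are orthogonal to the nonzero gradient of the switching
    function, so in the plane [X (p v) = q v *: p' v] for a scalar [q]
    ([sliding_field_tangent]); it does not vanish because the segment carries no
    pseudo-equilibrium.  A solution [z] with image the segment is [p \o s], where
    the position [s] is continuous by compactness and satisfies [s' = q \o s]
    ([solution_position]).  Since [q] has a constant sign, [s] is monotone, and
    the substitution [v = s t] turns the time integral of the divergence
    [E (z t)] into the integral of [E (p v) / |q v|] ([Rintegral_time_change]).
    Hence the integral does not depend on the solution.  A solution exists: its
    position is the inverse of the travel time, the primitive of [1 / |q|]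
    ([exists_solution]).  This gives [slow_divergence_integralE], which is the
    third statement.

    For the other two, only [E] and [q] have to be compared.  A coordinate
    change [T] with inverse [S] turns [p] into [S \o p] and [X] into its image
    under the inverse differential, so that [q] is unchanged, and so is [E],
    which is built from Lie derivatives ([slow_divergence_integral_pullback]).
    Multiplication of the two fields by a positive function [g] multiplies both
    [E] and [q] by [g] ([slow_divergence_integral_rescale]).

    The smoothness of [q] in the parameter and in [v] comes from the explicit
    quotient of [X . p'] by [p' . p'], in which both fields are replaced by smooth
    extensions: the switching boundary lies in the closures of both sides
    ([switching_closure]), where these extensions agree with the fields. *)

(** * Calculus of C^k maps *)

Section CkCalculus.
Variable R : realType.
Implicit Types U V W : normedModType R.

(** The difference [g - f] vanishes near [x], hence is differentiable there with
    zero differential. *)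
Lemma near_eq_differentiable V W (f g : V -> W) x :
  (\forall y \near x, f y = g y) -> differentiable f x -> differentiable g x.
Proof.
move=> fg df; pose r := g - f.
have r0 : \forall y \near x, r y = 0.
  by apply: filterS fg => y fgy; rewrite /r !fctE fgy subrr.
have rx0 : r x = 0 by exact: nbhs_singleton r0.
pose z : {linear V -> W} := \0.
have cz : continuous z by move=> y; exact: cvg_cst.
have rE : r \o shift x = cst (r x) + z +o_ 0 id.
  apply/eqaddoP => _/posnumP[eps]; rewrite near_simpl.
  move: r0; rewrite (near_shift 0)/= subr0; apply: filterS => y ry.
  rewrite !fctE/= ry rx0 addr0 subr0 normr0 mulr_ge0//.
have -> : g = f + r by rewrite /r addrC subrK.
apply: differentiableD => //; apply/diff_locallyP.
by rewrite (diff_unique cz rE).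
Qed.

Lemma eq_Ck V W k (A : set V) (f g : V -> W) : open A ->
  (forall x, A x -> f x = g x) -> Ck k A f -> Ck k A g.
Proof.
move=> oA; elim: k f g => [|k IH] f g fg /=.
  move=> Cf x Ax; have fgx : \forall y \near x, f y = g y.
    by apply: filterS (open_nbhs_nbhs (conj oA Ax)) => y; exact: fg.
  rewrite /prop_for /continuous_at -(fg x Ax).
  apply: cvg_trans (Cf x Ax); apply: near_eq_cvg.
  by apply: filterS fgx => y ->.
move=> [df Cf]; have fgn x : A x -> \forall y \near x, f y = g y.
  by move=> Ax; apply: filterS (open_nbhs_nbhs (conj oA Ax)) => y; exact: fg.
split=> [x Ax|v].
  exact: near_eq_differentiable (fgn _ Ax) (df x Ax).
apply: IH (Cf v) => x Ax; exact: near_eq_derive (fgn _ Ax).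
Qed.

Lemma sub_Ck V W k (A B : set V) (f : V -> W) :
  A `<=` B -> Ck k B f -> Ck k A f.
Proof.
move=> AB; elim: k f => [|k IH] f /=; first by move=> Cf x /AB/Cf.
by move=> [df Cf]; split=> [x /AB/df//|v]; exact: IH.
Qed.

Lemma Ck_pred V W k (A : set V) (f : V -> W) : Ck k.+1 A f -> Ck k A f.
Proof.
elim: k f => [|k IH] f /= [df Cf]; last by split=> // v; exact: IH.
by move=> x /df; exact: differentiable_continuous.
Qed.

Lemma Ck_cst V W k (A : set V) (c : W) : Ck k A (cst c).
Proof.
elim: k c => [|k IH] c /=; first by move=> x _; exact: cvg_cst.
split=> [x _|v]; first exact: differentiable_cst.
by rewrite (_ : 'D_v _ = cst 0) //; apply/funext => x; rewrite derive_cst.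
Qed.

Lemma Ck_id (V : normedModType R) k (A : set V) : open A -> Ck k A id.
Proof.
move=> oA; case: k => [|k]; first by move=> x _; exact: cvg_id.
split=> [x _|v]; first exact: ex_diff.
by apply: eq_Ck (Ck_cst k A v) => // x _; rewrite derive_id.
Qed.

Lemma CkD V W k (A : set V) (f g : V -> W) : open A ->
  Ck k A f -> Ck k A g -> Ck k A (f \+ g).
Proof.
move=> oA; elim: k f g => [|k IH] f g /=.
  by move=> Cf Cg x Ax; apply: cvgD; [exact: Cf|exact: Cg].
move=> [df Cf] [dg Cg]; split=> [x Ax|v].
  by apply: differentiableD; [exact: df|exact: dg].
apply: eq_Ck (IH _ _ (Cf v) (Cg v)) => // x Ax /=.
by rewrite deriveD//; apply: diff_derivable; [exact: df|exact: dg].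
Qed.

Lemma Ck_sum V W k (A : set V) (I : Type) (r : seq I) (f : I -> V -> W) :
  open A -> (forall i, Ck k A (f i)) ->
  Ck k A (fun x => \sum_(i <- r) f i x).
Proof.
move=> oA Cf; elim: r => [|i r IH].
  by apply: eq_Ck (Ck_cst k A 0) => // x _; rewrite big_nil.
by apply: eq_Ck (CkD oA (Cf i) IH) => // x _; rewrite big_cons.
Qed.

(** The product rule is the differential of the bilinear map
    [(a, v) |-> a *: v], composed with a pair. *)
Lemma is_diff_scale V W (a : V -> R) (f : V -> W) x :
  differentiable a x -> differentiable f x ->
  differentiable (fun y => a y *: f y) x /\
  'd (fun y => a y *: f y) x = (fun v => a x *: 'd f x v + 'd a x v *: f x)
    :> (V -> W).
Proof.
move=> da df.
have bl : bilinear_for (GRing.Scale.Law.clone _ _ *:%R _)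
    (GRing.Scale.Law.clone _ _ *:%R _) ( *:%R : R -> W -> W).
  split=> [u'|u] b y z /=; first by rewrite scalerDl scalerA.
  by rewrite scalerDr !scalerA mulrC.
pose sM := bilinear_isBilinear.Build R R W W _ _ ( *:%R : R -> W -> W) bl.
pose s : {bilinear R -> W -> W} := HB.pack ( *:%R : R -> W -> W) sM.
have cs : continuous (fun p : R * W => s p.1 p.2).
  by move=> p; exact: scale_continuous.
have -> : (fun y => a y *: f y) = (fun p => s p.1 p.2) \o (fun y => (a y, f y)).
  by [].
have dp : differentiable (fun y => (a y, f y)) x by exact: differentiable_pair.
have ds := differentiable_bilin (a x, f x) cs.
split; first exact: differentiable_comp.
by rewrite diff_comp// diff_pair// diff_bilin.
Qed.

Lemma CkZ V W k (A : set V) (a : V -> R) (f : V -> W) : open A ->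
  Ck k A a -> Ck k A f -> Ck k A (fun x => a x *: f x).
Proof.
move=> oA; elim: k a f => [|k IH] a f.
  move=> Ca Cf x Ax; exact: (cvgZ (Ca x Ax) (Cf x Ax)).
move=> Ca Cf; have [da Da] := Ca; have [df Df] := Cf.
split=> [x Ax|v]; first exact: (is_diff_scale (da x Ax) (df x Ax)).1.
have C1 := IH _ _ (Ck_pred Ca) (Df v).
have C2 := IH _ _ (Da v) (Ck_pred Cf).
apply: eq_Ck (CkD oA C1 C2) => // x Ax /=.
have [dd E] := is_diff_scale (da x Ax) (df x Ax).
rewrite [RHS]deriveE// E !deriveE//; [exact: da | exact: df].
Qed.

Lemma Ck_linear_comp V W (X : normedModType R) k (A : set V)
  (L : {linear W -> X}) (f : V -> W) : open A -> continuous L ->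
  Ck k A f -> Ck k A (L \o f).
Proof.
move=> oA cL; elim: k f => [|k IH] f.
  by move=> Cf x Ax; apply: continuous_comp; [exact: Cf|exact: cL].
move=> [df Cf]; have dL y : differentiable L y by exact: linear_differentiable.
split=> [x Ax|v]; first by apply: differentiable_comp => //; exact: df.
apply: eq_Ck (IH _ (Cf v)) => // x Ax /=.
have dfx := df x Ax.
rewrite [RHS]deriveE; last exact: differentiable_comp.
by rewrite diff_comp// diff_lin//= deriveE.
Qed.

Lemma Ck_pair V W (X : normedModType R) k (A : set V)
  (f : V -> W) (g : V -> X) : open A ->
  Ck k A f -> Ck k A g -> Ck k A (fun x => (f x, g x)).
Proof.
move=> oA; elim: k f g => [|k IH] f g.
  by move=> Cf Cg x Ax; apply: cvg_pair; [exact: Cf|exact: Cg].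
move=> [df Cf] [dg Cg]; split=> [x Ax|v].
  by apply: differentiable_pair; [exact: df|exact: dg].
apply: eq_Ck (IH _ _ (Cf v) (Cg v)) => // x Ax /=.
have dfx := df x Ax; have dgx := dg x Ax.
by rewrite [RHS]deriveE ?diff_pair ?deriveE//; exact: differentiable_pair.
Qed.

Lemma CkV V k (A : set V) (a : V -> R) : open A ->
  (forall x, A x -> a x != 0) -> Ck k A a -> Ck k A (fun x => (a x)^-1).
Proof.
move=> oA a0; elim: k => [|k IH] Ca.
  by move=> x Ax; apply: cvgV; [exact: a0|exact: Ca].
have [da Da] := Ca.
split=> [x Ax|v]; first by apply: differentiableV; [exact: da|exact: a0].
have C1 := IH (Ck_pred Ca).
have C2 := CkZ oA (Ck_cst k A (-1 : R)) (CkZ oA C1 (CkZ oA C1 (Da v))).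
apply: eq_Ck C2 => // x Ax.
have dax := da x Ax; have ax0 := a0 x Ax.
rewrite [RHS]deriveE; last exact: differentiableV.
rewrite diffV//= deriveE//=.
by rewrite scaleN1r !scalerA -invfM -expr2 scaleNr.
Qed.

(** Continuous linear coordinates in a finite generating family: they write a
    directional derivative of a composite as a finite sum of products. *)
Definition frame V (I : finType) (e : I -> V) (c : I -> {linear V -> R}) :=
  (forall i, continuous (c i)) /\ forall v, v = \sum_i c i v *: e i.

(** By induction on [k]: the chain rule at [x] has the moving direction
    ['D_v g x]; expanded in the frame, it only involves derivatives of [f] in the
    fixed directions [e i]. *)
Lemma Ck_comp V W (X : normedModType R) (I : finType) (e : I -> W)
  (c : I -> {linear W -> R}) k (A : set V) (B : set W)
  (f : W -> X) (g : V -> W) : frame e c -> open A ->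
  (forall x, A x -> B (g x)) -> Ck k A g -> Ck k B f -> Ck k A (f \o g).
Proof.
move=> [cc ce] oA gAB; elim: k f => [|k IH] f Cg Cf.
  move=> x Ax; apply: continuous_comp; [exact: Cg|exact: Cf (gAB x Ax)].
have [dg Dg] := Cg; have [df Df] := Cf.
split=> [x Ax|v].
  by apply: differentiable_comp; [exact: dg|exact: df (gAB x Ax)].
have C1 i : Ck k A (fun x => (c i \o 'D_v g) x *: ('D_(e i) f \o g) x).
  apply: (CkZ oA (Ck_linear_comp oA (cc i) (Dg v))).
  exact: (IH _ (Ck_pred Cg) (Df (e i))).
apply: eq_Ck (Ck_sum (index_enum I) oA C1) => // x Ax /=.
have dgx := dg x Ax; have dfx := df _ (gAB x Ax).
rewrite [RHS]deriveE; last exact: differentiable_comp.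
rewrite diff_comp//= -(deriveE v dgx) [in RHS](ce ('D_v g x)) linear_sum.
by apply: eq_bigr => i _; rewrite linearZ/= (deriveE (e i) dfx).
Qed.

Lemma diff_compE (U V W : normedModType R) (f : U -> V) (g : V -> W) x v :
  differentiable f x -> differentiable g (f x) ->
  'd (g \o f) x v = 'd g (f x) ('d f x v).
Proof. by move=> df dg; rewrite diff_comp. Qed.

Lemma derive_compE (U V W : normedModType R) (f : U -> V) (g : V -> W) x v :
  differentiable f x -> differentiable g (f x) ->
  'D_v (g \o f) x = 'd g (f x) ('D_v f x).
Proof.
move=> df dg; rewrite (deriveE v df) -diff_compE// deriveE//.
exact: differentiable_comp.
Qed.

Lemma mul_jacobian n k (f : 'rV[R]_n -> 'rV[R]_k) a v : v *m 'J f a = 'd f a v.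
Proof. by rewrite /jacobian mul_rV_lin1. Qed.

Lemma jacobian_inverse n (T S : 'rV[R]_n -> 'rV[R]_n) w :
  differentiable T w -> differentiable S (T w) ->
  (\forall y \near w, S (T y) = y) -> 'J T w \in unitmx.
Proof.
move=> dT dS TK.
suff JJ : 'J T w *m 'J S (T w) = 1%:M by exact: (mulmx1_unit JJ).1.
apply/row_matrixP => i; rewrite !rowE mulmxA !mul_jacobian mulmx1.
apply: etrans (derive_id w _); apply: esym.
rewrite -(near_eq_derive _ TK); apply: etrans (derive_compE _ dT dS) _.
by rewrite (deriveE _ dT).
Qed.

Lemma coord_is_linear n (i : 'I_n) : linear (fun v : 'rV[R]_n => v 0 i).
Proof. by move=> a u v; rewrite !mxE. Qed.

Definition coord n (i : 'I_n) : {linear 'rV[R]_n -> R} :=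
  HB.pack (fun v : 'rV[R]_n => v 0 i)
    (GRing.isLinear.Build _ _ _ _ _ (coord_is_linear i)).

Lemma continuous_coord n (i : 'I_n) : continuous (coord i).
Proof. by move=> x; exact: coord_continuous. Qed.

Lemma frame_row n : frame (fun i : 'I_n => delta_mx 0 i : 'rV[R]_n) (@coord n).
Proof. by split=> [i|v]; [exact: continuous_coord|exact: row_sum_delta]. Qed.

Lemma frame_prod (V W : normedModType R) (I J : finType) (e : I -> V)
    (f : J -> W) (c : I -> {linear V -> R}) (d : J -> {linear W -> R}) :
  frame e c -> frame f d ->
  frame (fun k : I + J => match k with
                          | inl i => (e i, 0) | inr j => (0, f j) end)
    (fun k => match k return {linear (V * W)%type -> R} with
     | inl i => c i \o fst | inr j => d j \o snd end).
Proof.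
move=> [cc ce] [cd ce']; split=> [[i|j] x|[v w]] /=.
- by apply: continuous_comp; [exact: cvg_fst|exact: cc].
- by apply: continuous_comp; [exact: cvg_snd|exact: cd].
rewrite big_sumType /=.
set X := (\sum_(i <- _ | _) _); set Y := (\sum_(i <- _ | _) _).
have X1 : X.1 = v.
  by rewrite [RHS]ce (raddf_sum fst).
have X2 : X.2 = 0 by rewrite (raddf_sum snd)/= big1// => i _; rewrite scaler0.
have Y1 : Y.1 = 0 by rewrite (raddf_sum fst)/= big1// => i _; rewrite scaler0.
have Y2 : Y.2 = w.
  by rewrite [RHS]ce' (raddf_sum snd).
by rewrite [RHS]surjective_pairing/= X1 X2 Y1 Y2 addr0 add0r.
Qed.

Lemma Ck_coord (V : normedModType R) n k (A : set V) (f : V -> 'rV[R]_n) i :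
  open A -> Ck k A f -> Ck k A (fun x => f x 0 i).
Proof.
move=> oA Cf.
by apply: (eq_Ck oA _ (Ck_linear_comp oA (@continuous_coord n i) Cf)) => x _.
Qed.

Lemma Ck_compose_prod (V W : normedModType R) l n k (A : set V)
    (B : set ('rV[R]_l * 'rV[R]_n)) (f : 'rV[R]_l * 'rV[R]_n -> W)
    (g : V -> 'rV[R]_l * 'rV[R]_n) :
  open A -> (forall x, A x -> B (g x)) -> Ck k A g -> Ck k B f ->
  Ck k A (f \o g).
Proof. exact: Ck_comp (frame_prod (frame_row l) (frame_row n)). Qed.

Lemma Ck_section (V W : normedModType R) k (a : V) (A : set W) : open A ->
  Ck k A (fun z => (a, z)).
Proof. by move=> oA; apply: Ck_pair => //; [exact: Ck_cst|exact: Ck_id]. Qed.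

Lemma open_preimage (V W : topologicalType) (A : set V) (B : set W)
    (f : V -> W) :
  open A -> open B -> (forall x, A x -> {for x, continuous f}) ->
  open (A `&` f @^-1` B).
Proof.
move=> oA oB cf; rewrite openE => x [Ax Bx]; apply: filterI.
  exact: open_nbhs_nbhs.
by apply: (cf x Ax); exact: open_nbhs_nbhs.
Qed.

Lemma open_section (V W : normedModType R) (B : set (V * W)) (a : V) : open B ->
  open [set z | B (a, z)].
Proof.
move=> oB; rewrite -[[set z | _]]setTI; apply: open_preimage openT oB _ => z _.
exact: (@Ck_section V W 0 a setT openT z I).
Qed.

Lemma smooth_on_section l n (W : normedModType R)
    (B : set ('rV[R]_l * 'rV[R]_n))
    (A : set 'rV[R]_n) (f : 'rV[R]_l -> 'rV[R]_n -> W) a :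
  open A -> (forall z, A z -> B (a, z)) -> smooth_on B (uncurried f) ->
  smooth_on A (f a).
Proof.
move=> oA AB sf k; have := Ck_compose_prod oA AB (Ck_section k a oA) (sf k).
by apply: eq_Ck.
Qed.

Lemma smooth_in_section l n (W : normedModType R)
    (B : set ('rV[R]_l * 'rV[R]_n))
    (A : set 'rV[R]_n) (f : 'rV[R]_l -> 'rV[R]_n -> W) a :
  (forall z, A z -> B (a, z)) -> smooth_in B (uncurried f) -> smooth_in A (f a).
Proof.
move=> AB [g [[U [oU BU sg]] fg]].
exists (fun z => g (a, z)); split.
  exists [set z | U (a, z)]; split; first exact: open_section.
    by move=> z /AB/BU.
  apply: (@smooth_on_section _ _ _ U _ (fun b z => g (b, z)) a) => //.
    exact: open_section.
  by rewrite (_ : uncurried _ = g)//; apply/funext => -[].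
by move=> z /set_mem/AB zB; rewrite -(fg (a, z))//; exact: mem_set.
Qed.

Lemma smooth_on_differentiable (V W : normedModType R) (A : set V)
    (f : V -> W) x :
  smooth_on A f -> A x -> differentiable f x.
Proof. by move=> sf; exact: (sf 1%N).1. Qed.

Lemma derive_section (V W X : normedModType R) (f : V -> W -> X) a z v :
  'D_(0, v) (uncurried f) (a, z) = 'D_v (f a) z.
Proof.
rewrite /derive; set F := fun s : R => _; set G := fun s : R => _.
suff -> : F = G by [].
by apply/funext => s; rewrite /F /G /uncurried /= scaler0 add0r.
Qed.

End CkCalculus.

(** * Continuity on subspaces *)

Lemma continuous_comp_within (S T U : topologicalType) (A : set S) (B : set T)
    (f : S -> T) (g : T -> U) :
  (forall x, A x -> B (f x)) -> {within A, continuous f} ->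
  {within B, continuous g} -> {within A, continuous (g \o f)}.
Proof.
move=> AB /subspace_continuousP cf /subspace_continuousP cg.
apply/subspace_continuousP => x Ax.
have fx : f y @[y --> within A (nbhs x)] --> within B (nbhs (f x)).
  move=> P BP; have := cf x Ax _ BP; rewrite /= /within /= => H.
  by apply: (@filterS _ (nbhs x) _ _ _ _ H) => y fyP Ay; exact: fyP (AB y Ay).
exact: (cvg_comp _ _ fx (cg _ (AB x Ax))).
Qed.

(** The inverse of a continuous injection of a compact set pulls closed sets
    back to images of compact sets, which are closed. *)
Lemma compact_inverse_continuous (S T : topologicalType) (K : set S)
    (f : S -> T) (g : T -> S) : hausdorff_space T -> compact K ->
  {within K, continuous f} -> {in K, cancel f g} ->
  {within f @` K, continuous g}.
Proof.
move=> hT cK cf fK; apply/continuous_closedP => C cC.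
apply/closed_subspaceP; exists (f @` (C `&` K)).
  apply: compact_closed => //; apply: continuous_compact.
    by apply: continuous_subspaceW cf => x [].
  by rewrite setIC; apply: compact_closedI.
apply/seteqP; split=> [y [[x [Cx Kx] <-] _]|y [Cgx [x Kx fx]]].
  split; last by exists x.
  by change (C (g (f x))); rewrite fK ?inE.
split; exists x => //; split=> //.
by move: Cgx; rewrite -fx; change (C (g (f x)) -> C x); rewrite fK ?inE.
Qed.

(** * Scalar products *)

Section ScalarProduct.
Variable R : realType.

Definition dot n (u v : 'rV[R]_n) : R := \sum_i u 0 i * v 0 i.

Lemma dotZr n (u v : 'rV[R]_n) (a : R) : dot u (a *: v) = a * dot u v.
Proof. by rewrite /dot mulr_sumr; apply: eq_bigr => i _; rewrite mxE mulrCA. Qed.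

Lemma dotZl n (u v : 'rV[R]_n) (a : R) : dot (a *: u) v = a * dot u v.
Proof. by rewrite /dot mulr_sumr; apply: eq_bigr => i _; rewrite mxE mulrA. Qed.

Lemma dotDr n (u v1 v2 : 'rV[R]_n) : dot u (v1 + v2) = dot u v1 + dot u v2.
Proof. by rewrite /dot -big_split; apply: eq_bigr => i _; rewrite mxE mulrDr. Qed.

Lemma dot_gt0 n (u : 'rV[R]_n) : u != 0 -> 0 < dot u u.
Proof.
move=> u0; rewrite lt_neqAle eq_sym; apply/andP; split; last first.
  by apply: sumr_ge0 => i _; rewrite -expr2 sqr_ge0.
apply: contra u0; rewrite psumr_eq0 => [/allP h|i _]; last first.
  by rewrite -expr2 sqr_ge0.
apply/eqP/rowP => i; rewrite mxE.
by have := h i (mem_index_enum i); rewrite mulf_eq0 orbb => /eqP.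
Qed.

Lemma is_derive_linear_comp (V W : normedModType R) (L : {linear V -> W})
    (p : R -> V) (t : R) (u : V) : continuous L ->
  is_derive t 1 p u -> is_derive t 1 (L \o p) (L u).
Proof.
move=> cL [dp pu]; have Dp : differentiable p t by exact/derivable1_diffP.
have DL y : differentiable L y by exact: linear_differentiable.
have DLp : differentiable (L \o p) t by exact: differentiable_comp.
apply: DeriveDef; first exact/derivable1_diffP.
by rewrite deriveE// diff_comp//= diff_lin// -(deriveE (1 : R) Dp) pu.
Qed.

Lemma is_derive_dot n (u d : 'rV[R]_n) (z : R -> 'rV[R]_n) (t : R) :
  is_derive t 1 z d -> is_derive t 1 (fun s => dot u (z s)) (dot u d).
Proof.
have lin : linear (dot u).
  by move=> a x y; rewrite dotDr dotZr.
pose LM := GRing.isLinear.Build _ _ _ _ _ lin.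
pose L : {linear 'rV[R]_n -> R} := HB.pack (dot u) LM.
have cL : continuous L.
  suff C0 : Ck 0 setT (dot u) by move=> x; exact: C0.
  apply: (Ck_sum _ openT) => i x _.
  apply: (@continuous_comp _ _ _ (fun y : 'rV[R]_n => y 0 i) ( *%R (u 0 i))).
    exact: coord_continuous.
  exact: mulrl_continuous.
exact: (is_derive_linear_comp cL).
Qed.

Lemma cvg_sum_seq (T : Type) (F : set_system T) (V : normedModType R) (J : Type)
    (r : seq J) (f : J -> T -> V) (l : J -> V) : Filter F ->
  (forall j, f j x @[x --> F] --> l j) ->
  (\sum_(j <- r) f j x) @[x --> F] --> \sum_(j <- r) l j.
Proof.
move=> FF fl; elim: r => [|j r IH].
  by rewrite big_nil; under eq_fun do rewrite big_nil; exact: cvg_cst.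
by rewrite big_cons; under eq_fun do rewrite big_cons; apply: cvgD.
Qed.

Lemma cvg_dot (T : Type) (F : set_system T) n (f g : T -> 'rV[R]_n)
    (u v : 'rV[R]_n) :
  Filter F -> f x @[x --> F] --> u -> g x @[x --> F] --> v ->
  dot (f x) (g x) @[x --> F] --> dot u v.
Proof.
move=> FF fu gv; apply: cvg_sum_seq => i; apply: cvgM.
  apply: (@cvg_comp _ _ _ f (fun y : 'rV[R]_n => y 0 i) _ (nbhs u)) => //.
  exact: coord_continuous.
apply: (@cvg_comp _ _ _ g (fun y : 'rV[R]_n => y 0 i) _ (nbhs v)) => //.
exact: coord_continuous.
Qed.

Lemma cvg_row (T : Type) (F : set_system T) n (f : T -> 'rV[R]_n)
    (u : 'rV[R]_n) :
  Filter F -> (forall i, f x 0 i @[x --> F] --> u 0 i) -> f x @[x --> F] --> u.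
Proof.
move=> FF fu; rewrite (row_sum_delta u).
have -> : f = (fun x => \sum_i f x 0 i *: delta_mx 0 i).
  by apply/funext => x; rewrite -row_sum_delta.
by apply: cvg_sum_seq => i; apply: cvgZl; exact: fu.
Qed.

Lemma dot_gradient (f : 'rV[R]_2 -> R) z u :
  differentiable f z -> dot (gradient f z) u = 'd f z u.
Proof.
move=> df; rewrite [in RHS](row_sum_delta u) linear_sum.
by apply: eq_bigr => i _; rewrite linearZ/= mxE mulrC -deriveE.
Qed.

(** In the plane the vectors orthogonal to [g] form a line. *)
Lemma collinear_orthogonal (g x y : 'rV[R]_2) :
  g != 0 -> y != 0 -> dot g x = 0 -> dot g y = 0 ->
  x = (dot x y / dot y y) *: y.
Proof.
move=> g0 y0 gx gy; have yy := dot_gt0 y0.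
have E (u v : 'rV[R]_2) : dot u v = u 0 0 * v 0 0 + u 0 1 * v 0 1.
  rewrite /dot !big_ord_recl big_ord0 addr0 (_ : lift _ _ = 1)//.
  exact/val_inj.
have g01 : g 0 0 != 0 \/ g 0 1 != 0.
  have [h0|] := eqVneq (g 0 0) 0; last by left.
  right; apply: contra g0 => /eqP h1; apply/eqP/rowP => i; rewrite mxE.
  case: (unliftP ord0 i) => [j ->|->]//.
  by rewrite (_ : lift _ _ = 1)//; apply/val_inj; rewrite ord1.
have cross : x 0 0 * y 0 1 = x 0 1 * y 0 0.
  rewrite !E in gx gy; case: g01 => h; apply: (mulfI h).
    have -> : g 0 0 * (x 0 0 * y 0 1) = (g 0 0 * x 0 0) * y 0 1 by rewrite mulrA.
    have -> : g 0 0 * (x 0 1 * y 0 0) = (g 0 0 * y 0 0) * x 0 1.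
      by rewrite mulrCA mulrC.
    have -> : g 0 0 * x 0 0 = - (g 0 1 * x 0 1) by lra.
    have -> : g 0 0 * y 0 0 = - (g 0 1 * y 0 1) by lra.
    by rewrite !mulNr mulrAC.
  have -> : g 0 1 * (x 0 1 * y 0 0) = (g 0 1 * x 0 1) * y 0 0 by rewrite mulrA.
  have -> : g 0 1 * (x 0 0 * y 0 1) = (g 0 1 * y 0 1) * x 0 0.
    by rewrite mulrCA mulrC.
  have -> : g 0 1 * x 0 1 = - (g 0 0 * x 0 0) by lra.
  have -> : g 0 1 * y 0 1 = - (g 0 0 * y 0 0) by lra.
  by rewrite !mulNr mulrAC.
apply/rowP => i; rewrite mxE; apply: (mulfI (lt0r_neq0 yy)).
rewrite mulrA [_ * (_ / _)]mulrC divfK ?gt_eqF// !E.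
have c0 : y 0 1 * (x 0 0 * y 0 1) = y 0 1 * (x 0 1 * y 0 0) by rewrite cross.
have c1 : y 0 0 * (x 0 0 * y 0 1) = y 0 0 * (x 0 1 * y 0 0) by rewrite cross.
case: (unliftP ord0 i) => [j ->|->]; last by lra.
by rewrite (_ : lift _ _ = 1); [lra|apply/val_inj; rewrite ord1].
Qed.

End ScalarProduct.

(** * Inverses and changes of variable on the line *)

Section RealCurves.
Variable R : realType.

(** The difference quotient of [f \o s] is the difference quotient of [f] along
    [s] times that of [s]; as the first factor tends to [c], which is nonzero, the
    second one converges. *)
Lemma is_derive1_cancel_comp (f s : R -> R) (t c d : R) :
  is_derive (s t) 1 f c -> c != 0 -> {for t, continuous s} ->
  is_derive t 1 (f \o s) d -> is_derive t 1 s (d / c).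
Proof.
move=> /is_derive1_caratheodory[g [fE cg gE]] c0 cs.
move=> /is_derive1_caratheodory[k [kE ck kt]].
apply/is_derive1_caratheodory.
(* The value at [t] is the slope that has to be proved. *)
exists (fun y => if y == t then d / c else (s y - s t) / (y - t)); split.
- move=> y; case: eqP => [->|/eqP]; first by rewrite !subrr mulr0.
  by rewrite -subr_eq0 => /divfK ->.
- have cgs : {for t, continuous (g \o s)} by apply: continuous_comp.
  have gs0 : \forall y \near t, g (s y) != 0.
    apply: (cgs [set u | u != 0]); apply: open_nbhs_nbhs.
    by split; [exact: open_neq|rewrite /= gE].
  have h : k y / g (s y) @[y --> t] --> d / c.
    rewrite -kt -gE; apply: cvgM; first exact: ck.
    by apply: cvgV; [rewrite gE|exact: cgs].
  rewrite /prop_for /continuous_at eqxx; apply: cvg_trans h.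
  apply: near_eq_cvg; apply: filterS gs0 => y gy0.
  case: eqP => [->|/eqP yt]; first by rewrite kt gE.
  have /(canRL (mulfK _)) -> // : k y * (y - t) = g (s y) * (s y - s t).
    by rewrite -kE -fE.
  rewrite mulrAC [g _ * _]mulrC mulrK ?unitfE//.
  by rewrite subr_eq0.
by rewrite eqxx.
Qed.

Lemma is_derive_curve_comp (V : normedModType R) (p : R -> V) (s : R -> R)
    (t d : R) (u : V) :
  is_derive (s t) 1 p u -> is_derive t 1 s d ->
  is_derive t 1 (p \o s) (d *: u).
Proof.
move=> [dp pu] [ds sd].
have Dp : differentiable p (s t) by exact/derivable1_diffP.
have Ds : differentiable s t by exact/derivable1_diffP.
have Dps : differentiable (p \o s) t by exact: differentiable_comp.
apply: DeriveDef; first exact/derivable1_diffP.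
rewrite deriveE// diff_comp//= -(deriveE (1 : R) Ds) sd.
have {1}-> : d = d *: (1 : R) by rewrite [RHS]mulr1.
by rewrite linearZ/= -(deriveE (1 : R) Dp) pu.
Qed.

Lemma nonvanishing_sign (a b : R) (q : R -> R) : a <= b ->
  {within `[a, b], continuous q} -> {in `[a, b], forall v, q v != 0} ->
  {in `[a, b], forall v, 0 < q v} \/ {in `[a, b], forall v, q v < 0}.
Proof.
move=> ab cq q0.
have H v : v \in `[a, b] -> ~ Num.min (q a) (q v) <= 0 <= Num.max (q a) (q v).
  move=> vab; have av : a <= v by rewrite (itvP vab).
  have cav : {within `[a, v], continuous q}.
    apply: continuous_subspaceW cq; apply: subset_itvl.
    by rewrite bnd_simp (itvP vab).
  move=> /(IVT av cav)[c cav' qc].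
  have /q0 : c \in `[a, b].
    move: cav'; rewrite !in_itv/= => /andP[-> /le_trans]; apply.
    by rewrite (itvP vab).
  by rewrite qc eqxx.
have [qa|qa|qa] := ltgtP (q a) 0.
- right=> v /H qv; rewrite ltNge; apply/negP => h; apply: qv.
  by rewrite ge_min le_max h (ltW qa) orbT.
- left=> v /H qv; rewrite ltNge; apply/negP => h; apply: qv.
  by rewrite ge_min le_max h (ltW qa) orbT.
- by have := q0 a; rewrite qa eqxx bound_itvE => /(_ ab).
Qed.

(** The autonomous equation [s' = q s] makes [s] strictly monotone, so that
    [v = s t] is an admissible substitution, with [dt = dv / |q v|] for both
    directions of motion. *)
Lemma Rintegral_time_change (a b t1 t2 : R) (s q G : R -> R) : t1 < t2 ->
  {within `[t1, t2], continuous s} ->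
  {in `]t1, t2[, forall t : R, is_derive t 1 s (q (s t))} ->
  s @` `[t1, t2] = `[a, b]%classic ->
  {within `[a, b], continuous q} -> {in `[a, b], forall v, q v != 0} ->
  {within `[a, b], continuous G} ->
  \int[lebesgue_measure]_(t in `[t1, t2]) G (s t)
  = \int[lebesgue_measure]_(v in `[a, b]) (G v / `|q v|).
Proof.
move=> t12 cs ds sim cq q0 cG.
have sab t : t \in `[t1, t2] -> s t \in `[a, b].
  by move=> tt; have : (s @` `[t1, t2]) (s t) by [exists t]; rewrite sim.
have t1I : t1 \in `[t1, t2] by rewrite bound_itvE ltW.
have t2I : t2 \in `[t1, t2] by rewrite bound_itvE ltW.
have ab : a <= b.
  have := sab _ t1I; rewrite in_itv/= => /andP[]; exact: le_trans.
have oc t : t \in `]t1, t2[ -> t \in `[t1, t2] by exact: subset_itv_oo_cc.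
pose H v := G v / `|q v|.
have cH : {within `[a, b], continuous H}.
  apply/subspace_continuousP => v vab; apply: cvgM.
    exact: (subspace_continuousP _ _).1 cG v vab.
  apply: cvgV; first by rewrite normr_eq0 q0.
  exact: cvg_norm ((subspace_continuousP _ _).1 cq v vab).
have cGs : {within `[t1, t2], continuous (G \o s)}.
  exact: continuous_comp_within cs cG.
have cqs : {within `[t1, t2], continuous (q \o s)}.
  exact: continuous_comp_within cs cq.
have s'E : {in `]t1, t2[, derive1 s =1 q \o s}.
  by move=> t tt; rewrite derive1E; have [] := ds t tt.
have dsb : derivable_oo_LRcontinuous s t1 t2.
  have [_ c1 c2] := (continuous_within_itvP s t12).1 cs.
  by split=> // t tt; have [] := ds t tt.
have [cqo cq1 cq2] := (continuous_within_itvP (q \o s) t12).1 cqs.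
have cs' : {in `]t1, t2[, continuous (derive1 s)}.
  move=> t tt; have := cqo t tt; rewrite /prop_for /continuous_at.
  rewrite -(s'E t tt); apply: cvg_trans; apply: near_eq_cvg.
  by apply: filterS (near_in_itvoo tt) => x xx; exact/esym/s'E.
have cs1 : cvg ((derive1 s) x @[x --> t1^'+]).
  apply: cvgP (q (s t1)) _; apply: cvg_trans cq1; apply: near_eq_cvg.
  near=> x; apply/esym/s'E; rewrite in_itv/=; apply/andP; split; near: x.
    exact: nbhs_right_gt.
  exact: nbhs_right_lt.
have cs2 : cvg ((derive1 s) x @[x --> t2^'-]).
  apply: cvgP (q (s t2)) _; apply: cvg_trans cq2; apply: near_eq_cvg.
  near=> x; apply/esym/s'E; rewrite in_itv/=; apply/andP; split; near: x.
    exact: nbhs_left_gt.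
  exact: nbhs_left_lt.
have mG : measurable_fun `]t1, t2[ (G \o s).
  apply: subspace_continuous_measurable_fun => //.
  by apply: continuous_subspaceW cGs; exact: subset_itv_oo_cc.
rewrite /Rintegral; congr fine.
(* The two signs of [q] are the two directions of motion. *)
have [qp|qn] := nonvanishing_sign ab cq q0.
- have incs : {in `[t1, t2] &, {homo s : x y / x < y}}.
    apply: (gtr0_derive1_lt_cc _ _ cs) => t tt; first by have [] := ds t tt.
    by rewrite s'E// qp// sab// oc.
  have st1 : s t1 = a.
    have [x xI xa] : (s @` `[t1, t2]) a by rewrite sim /= bound_itvE.
    apply/eqP; rewrite eq_le; have := sab _ t1I; rewrite in_itv/= => /andP[-> _].
    rewrite andbT -xa; have : t1 <= x by rewrite (itvP xI).
    exact: (ltW_homo_in incs).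
  have st2 : s t2 = b.
    have [x xI xa] : (s @` `[t1, t2]) b by rewrite sim /= bound_itvE.
    apply/eqP; rewrite eq_le; have := sab _ t2I; rewrite in_itv/= => /andP[_ ->].
    rewrite -xa/=; have : x <= t2 by rewrite (itvP xI).
    exact: (ltW_homo_in incs).
  have -> : (\int[lebesgue_measure]_(x in `[a, b]) (G x / `|q x|)%:E
     = \int[lebesgue_measure]_(x in `[t1, t2]) (((H \o s) * (derive1 s)) x)%:E)%E.
    have cH' : {within `[s t1, s t2], continuous H} by rewrite st1 st2.
    rewrite -(integration_by_substitution_increasing _ _ cs' cs1 cs2 dsb cH')//;
      last exact: ltW.
    by rewrite st1 st2.
  have E : {in `]t1, t2[, G \o s =1 (H \o s) * (derive1 s)}.
    move=> t tt; rewrite !fctE/= s'E//= /H.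
    by rewrite gtr0_norm ?qp ?sab ?oc// divfK// q0// sab// oc.
  apply: eq_integral_itv_bounded => //.
  by apply: eq_measurable_fun mG => t; rewrite inE => tt; exact: E.
have decs : {in `[t1, t2] &, {homo s : x y /~ x < y}}.
  apply: (ltr0_derive1_lt_cc _ _ cs) => t tt; first by have [] := ds t tt.
  by rewrite s'E// qn// sab// oc.
have st1 : s t1 = b.
  have [x xI xa] : (s @` `[t1, t2]) b by rewrite sim /= bound_itvE.
  apply/eqP; rewrite eq_le; have := sab _ t1I; rewrite in_itv/= => /andP[_ ->].
  rewrite -xa/=; have : t1 <= x by rewrite (itvP xI).
  exact: (ltW_nhomo_in decs).
have st2 : s t2 = a.
  have [x xI xa] : (s @` `[t1, t2]) a by rewrite sim /= bound_itvE.
  apply/eqP; rewrite eq_le; have := sab _ t2I; rewrite in_itv/= => /andP[-> _].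
  rewrite -xa andbT; have : x <= t2 by rewrite (itvP xI).
  exact: (ltW_nhomo_in decs).
have -> : (\int[lebesgue_measure]_(x in `[a, b]) (G x / `|q x|)%:E
   = \int[lebesgue_measure]_(x in `[t1, t2]) (((H \o s) * (- derive1 s)) x)%:E)%E.
  have cH' : {within `[s t2, s t1], continuous H} by rewrite st1 st2.
  rewrite -(integration_by_substitution_decreasing _ _ cs' cs1 cs2 dsb cH')//;
    last exact: ltW.
  by rewrite st1 st2.
have E : {in `]t1, t2[, G \o s =1 (H \o s) * - (derive1 s)}.
  move=> t tt; rewrite !fctE/= s'E//= /H.
  by rewrite ltr0_norm ?qn ?sab ?oc// divfK// oppr_eq0 q0// sab// oc.
apply: eq_integral_itv_bounded => //.
by apply: eq_measurable_fun mG => t; rewrite inE => tt; exact: E.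
Unshelve. all: by end_near. Qed.

(** At an end point only one side of the point lies in the segment, so the
    derivative is computed as a one-sided limit of slopes, which are zero. *)
Lemma derive_eq0_segment (v1 v2 v c : R) (f : R -> R) : v1 < v2 ->
  v \in `[v1, v2] -> {in `[v1, v2], forall u, f u = 0} ->
  is_derive v 1 f c -> c = 0.
Proof.
move=> v12 vI f0 /is_derive1_caratheodory[g [fE cg <-]].
have g0 u : u \in `[v1, v2] -> u != v -> g u = 0.
  move=> uI uv; have := fE u; rewrite !f0// subrr => /esym/eqP.
  by rewrite mulf_eq0 subr_eq0 (negPf uv) orbF => /eqP.
move: (vI); rewrite in_itv/= => /andP[+ vv2].
rewrite le_eqVlt => /orP[/eqP v1v|v1v].
- have gr : g u @[u --> v^'+] --> g v by exact: cvg_at_right_filter.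
  apply: (cvg_unique (@Rhausdorff R) gr).
  apply: cvg_near_cst; near=> u; apply: g0; last by rewrite gt_eqF//.
  by rewrite in_itv/= v1v ltW//=; near: u; apply: nbhs_right_le; rewrite -v1v.
- have gl : g u @[u --> v^'-] --> g v by exact: cvg_at_left_filter.
  apply: (cvg_unique (@Rhausdorff R) gl).
  apply: cvg_near_cst; near=> u.
  have uv : u < v by near: u; exact: nbhs_left_lt.
  apply: g0; last by rewrite lt_eqF.
  rewrite in_itv/= (le_trans (ltW uv) vv2) andbT.
  by near: u; exact: nbhs_left_ge.
Unshelve. all: by end_near. Qed.

End RealCurves.

(** * Time along a sliding segment *)

Section TimeAlongSegment.
Variable R : realType.

Lemma regular_paramP (m : set 'rV[R]_2) v1 v2 p : regular_param m v1 v2 p ->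
  [/\ v1 < v2, {in `[v1, v2] &, injective p},
      {in `[v1, v2], forall v : R, is_derive v 1 p (derive1 p v)},
      {within `[v1, v2], continuous p} & p @` `[v1, v2] = m].
Proof.
move=> [v12 [U [oU IU sp]] pinj _ pim].
have dp v : v \in `[v1, v2] -> differentiable p v.
  by move=> vI; apply: (sp 1%N).1; exact: IU.
split; [exact: v12|exact: pinj|move=> v vI| |exact: pim].
  by rewrite derive1E; apply/derivableP/derivable1_diffP/dp.
apply: continuous_in_subspaceT => v; rewrite inE => vI.
by apply: differentiable_continuous; exact: dp.
Qed.

(** The solution runs through the segment with the position
    [s = p^-1 \o z], which is continuous because [p] is a homeomorphism onto its
    compact image; differentiating [z = p \o s] gives its speed. *)
Lemma solution_position (D : pws R) (m : set 'rV[R]_2) (v1 v2 t1 t2 : R)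
    (p z : R -> 'rV[R]_2) (q : R -> R) :
  regular_param m v1 v2 p ->
  {in `[v1, v2], forall v, sliding_field D (p v) = q v *: derive1 p v} ->
  sliding_solution D m t1 t2 z ->
  exists s : R -> R, [/\ {within `[t1, t2], continuous s},
    {in `]t1, t2[, forall t : R, is_derive t 1 s (q (s t))},
    s @` `[t1, t2] = `[v1, v2]%classic
    & {in `[t1, t2], forall t, z t = p (s t)}].
Proof.
move=> Hp Xq [t12 cz dz _ zim].
have [v12 pinj dp cp pim] := regular_paramP Hp.
have [_ _ _ dp0 _] := Hp.
pose g : 'rV[R]_2 -> R := pinv `[v1, v2] p; pose s := g \o z.
have pK : {in `[v1, v2]%classic, cancel p g}.
  by apply: pinvKV => x y; rewrite !inE; exact: pinj.
have cg : {within m, continuous g}.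
  rewrite -pim; apply: compact_inverse_continuous => //.
  exact: segment_compact.
have cs : {within `[t1, t2], continuous s}.
  apply: (continuous_comp_within _ cz cg) => t tI.
  by rewrite -zim; exists t.
have oc t : t \in `]t1, t2[ -> t \in `[t1, t2] by exact: subset_itv_oo_cc.
have zE t : t \in `[t1, t2] -> exists2 v, v \in `[v1, v2] & z t = p v /\ s t = v.
  move=> tI; have : m (z t) by rewrite -zim; exists t.
  rewrite -pim => -[v vI pv]; exists v => //; split; first by [].
  by rewrite /s /= -pv pK ?inE.
have ps t : t \in `[t1, t2] -> z t = p (s t).
  by move=> /zE[v _ [-> ->]].
exists s; split=> //.
- move=> t tI.
  have tI' := oc t tI.
  have [v vI [_ stv]] := zE t tI'; rewrite -stv in vI.
  set u := derive1 p (s t).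
  have u0 : dot u u != 0 by rewrite gt_eqF// dot_gt0// dp0.
  (* The scalar product with the velocity [u] at the current position reduces
     the differentiation of [s] to that of real functions. *)
  have Df : is_derive (s t) 1 (fun x => dot u (p x)) (dot u u).
    by apply: is_derive_dot; exact: dp.
  have Dfs : is_derive t 1 ((fun x => dot u (p x)) \o s) (q (s t) * dot u u).
    rewrite -dotZr -Xq// -ps//.
    have := is_derive_dot u (dz t tI).
    apply: near_eq_is_derive; apply: filterS (near_in_itvoo tI) => y yI /=.
    by rewrite ps// oc.
  have cst := within_continuous_continuous t12 cs tI.
  by have := is_derive1_cancel_comp Df u0 cst Dfs; rewrite mulfK.
- apply/seteqP; split=> [_ [t tI <-]|v vI].
    by have [v vI [_ ->]] := zE t tI.
  have : m (p v) by rewrite -pim; exists v.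
  rewrite -zim => -[t tI zt]; exists t => //.
  by rewrite /s /= zt pK ?inE.
Qed.

Lemma solution_integral (D : pws R) (m : set 'rV[R]_2) (v1 v2 t1 t2 : R)
    (p z : R -> 'rV[R]_2) (q : R -> R) (E : 'rV[R]_2 -> R) :
  regular_param m v1 v2 p ->
  {within `[v1, v2], continuous q} ->
  {in `[v1, v2], forall v, q v != 0} ->
  {in `[v1, v2], forall v, sliding_field D (p v) = q v *: derive1 p v} ->
  {within `[v1, v2], continuous (E \o p)} ->
  sliding_solution D m t1 t2 z ->
  \int[lebesgue_measure]_(t in `[t1, t2]) E (z t)
  = \int[lebesgue_measure]_(v in `[v1, v2]) (E (p v) / `|q v|).
Proof.
move=> Hp cq q0 Xq cE Hz.
have [s [cs ds sim zs]] := solution_position Hp Xq Hz.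
have [t12 _ _ _ _] := Hz.
rewrite -(Rintegral_time_change t12 cs ds sim cq q0 cE).
by apply: eq_Rintegral => t; rewrite inE => tI /=; rewrite zs.
Qed.

(** The time needed to reach the position [v] is the integral of [1 / q]; its
    inverse function is the position at a given time. *)
Lemma exists_solution_pos (D : pws R) (m : set 'rV[R]_2) (v1 v2 : R)
    (p : R -> 'rV[R]_2) (q : R -> R) :
  v1 < v2 -> {in `[v1, v2] &, injective p} ->
  {within `[v1, v2], continuous p} -> p @` `[v1, v2] = m ->
  {within `[v1, v2], continuous q} ->
  {in `[v1, v2], forall v, 0 < q v} ->
  {in `[v1, v2], forall v : R,
    is_derive v 1 p ((q v)^-1 *: sliding_field D (p v))} ->
  exists t1 t2 z, sliding_solution D m t1 t2 z.
Proof.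
move=> v12 pinj cp pim cq q0 dp.
pose r v := (q v)^-1.
have cr : {within `[v1, v2], continuous r}.
  apply/subspace_continuousP => v vI; apply: cvgV; first by rewrite gt_eqF ?q0.
  exact: (subspace_continuousP _ _).1 cq v vI.
have ir : lebesgue_measure.-integrable `[v1, v2] (EFin \o r).
  by apply: continuous_compact_integrable => //; exact: segment_compact.
pose T v := \int[lebesgue_measure]_(x in `[v1, v]) r x.
have cT : {within `[v1, v2], continuous T}.
  exact: parameterized_integral_continuous (ltW v12) ir.
have oc v : v \in `]v1, v2[ -> v \in `[v1, v2] by exact: subset_itv_oo_cc.
have dT v : v \in `]v1, v2[ -> derivable T v 1 /\ derive1 T v = r v.
  move=> vI; apply: (continuous_FTC1_closed (u := v2)) => //.
  - by rewrite (itvP vI).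
  - by rewrite (itvP vI).
  - exact: within_continuous_continuous vI.
have incT : {in `[v1, v2] &, {homo T : x y / x < y}}.
  apply: (gtr0_derive1_lt_cc _ _ cT) => v vI; first by have [] := dT v vI.
  by rewrite (dT v vI).2 invr_gt0 q0// oc.
have monoT := le_mono_in incT.
have injT : {in `[v1, v2] &, injective T} := inc_inj_in monoT.
pose g : R -> R := pinv `[v1, v2] T.
have TK : {in `[v1, v2], cancel T g}.
  move=> v vI; apply: pinvKV; last by rewrite inE.
  by move=> x y; rewrite !inE; exact: injT.
have v1I : v1 \in `[v1, v2] by rewrite bound_itvE ltW.
have v2I : v2 \in `[v1, v2] by rewrite bound_itvE ltW.
have T12 : T v1 < T v2 by exact: incT.
have cg : {within `[T v1, T v2], continuous g}.
  exact: segment_can_le_continuous (ltW v12) cT TK.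
have gK : {in `[T v1, T v2], cancel g T}.
  exact: segment_continuous_le_can_sym (ltW v12) cT TK.
have gE t : t \in `[T v1, T v2] -> exists2 v, v \in `[v1, v2] & T v = t.
  move=> tI; apply: (IVT (ltW v12) cT); move: tI.
  by rewrite in_itv/= /Num.min /Num.max T12.
have gI t : t \in `[T v1, T v2] -> g t \in `[v1, v2].
  by move=> /gE[v vI <-]; rewrite TK.
have oT t : t \in `]T v1, T v2[ -> t \in `[T v1, T v2].
  by exact: subset_itv_oo_cc.
exists (T v1), (T v2), (p \o g); split; first exact: T12.
- by apply: (continuous_comp_within _ cg cp) => t; exact: gI.
- move=> t tI.
  have tI' := oT t tI.
  have [v vI Tv] := gE t tI'; have gv : g t = v by rewrite -Tv TK.
  have vI' : v \in `]v1, v2[.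
    move: (tI); rewrite -Tv !in_itv/= => /andP[].
    by rewrite !(leW_mono_in monoT)// => -> ->.
  have [dTv Tv'] := dT v vI'.
  have Dg : is_derive t 1 g (q v).
    have DT : is_derive (g t) 1 T (r v).
      by rewrite gv -Tv' derive1E; exact: derivableP dTv.
    have Did : is_derive t 1 (T \o g) 1.
      apply: near_eq_is_derive (is_derive_id t 1).
      apply: filterS (near_in_itvoo tI) => y yI /=.
      by rewrite gK// oT.
    have r0 : r v != 0 by rewrite invr_eq0 gt_eqF ?q0.
    have cgt := within_continuous_continuous T12 cg tI.
    by have := is_derive1_cancel_comp DT r0 cgt Did; rewrite div1r invrK.
  have Dp := dp v vI; rewrite -{1}gv in Dp.
  have := is_derive_curve_comp Dp Dg.
  by rewrite scalerA divff ?scale1r ?gt_eqF ?q0//= gv.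
- move=> x y xI yI /= pg; rewrite -(gK x xI) -(gK y yI); congr T.
  by apply: pinj => //; exact: gI.
- rewrite -pim; apply/seteqP; split=> [_ [t tI <-]|_ [v vI <-]].
    by exists (g t) => //; exact: gI.
  exists (T v); last by rewrite /= TK.
  by rewrite /= in_itv/= !monoT// !(itvP vI).
Qed.

Lemma exists_solution (D : pws R) (m : set 'rV[R]_2) (v1 v2 : R)
    (p : R -> 'rV[R]_2) (q : R -> R) :
  regular_param m v1 v2 p ->
  {within `[v1, v2], continuous q} ->
  {in `[v1, v2], forall v, q v != 0} ->
  {in `[v1, v2], forall v, sliding_field D (p v) = q v *: derive1 p v} ->
  exists t1 t2 z, sliding_solution D m t1 t2 z.
Proof.
move=> Hp cq q0 Xq; have [v12 pinj dp cp pim] := regular_paramP Hp.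
have [qp|qn] := nonvanishing_sign (ltW v12) cq q0.
  apply: (exists_solution_pos v12 pinj cp pim cq qp) => v vI.
  by rewrite Xq// scalerA mulVf ?q0// scale1r; exact: dp.
(* A negative [q] becomes positive along the reversed parameterization. *)
pose n (v : R) := v1 + v2 - v.
have nK : involutive n by move=> v; rewrite /n subKr.
have nI v : v \in `[v1, v2] -> n v \in `[v1, v2].
  by rewrite !in_itv/= /n => /andP[a b]; apply/andP; split; lra.
have dn (v : R) : is_derive v 1 n (-1).
  have -> : n = cst (v1 + v2) - id by [].
  by apply: is_derive_eq; rewrite sub0r.
have cn : {within `[v1, v2], continuous n}.
  apply: continuous_subspaceT => v; apply: differentiable_continuous.
  by apply/derivable1_diffP; have [] := dn v.
apply: (@exists_solution_pos D m v1 v2 (p \o n) (fun v => - q (n v))).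
- exact: v12.
- move=> x y xI yI /= /pinj h; rewrite -(nK x) -(nK y) h//; exact: nI.
- by apply: (continuous_comp_within _ cn cp) => v; exact: nI.
- rewrite -pim; apply/seteqP; split=> [_ [v vI <-]|_ [v vI <-]].
    by exists (n v) => //; exact: nI.
  by exists (n v); [exact: nI|rewrite /= nK].
- have : {within `[v1, v2], continuous (q \o n)}.
    by apply: (continuous_comp_within _ cn cq) => v; exact: nI.
  move=> cqn; apply/subspace_continuousP => v vI; apply: cvgN.
  exact: (subspace_continuousP _ _).1 cqn v vI.
- by move=> v vI; rewrite oppr_gt0 qn// nI.
- move=> v vI; have := is_derive_curve_comp (dp (n v) (nI v vI)) (dn v).
  by rewrite /= Xq ?nI// scalerA invrN mulNr mulVf ?q0 ?nI.
Qed.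

(** The set of values from which the slow divergence integral is chosen
    consists of the right-hand side only: it is nonempty by [exists_solution], and
    [solution_integral] computes each of its elements. *)
Theorem slow_divergence_integralE (phi : R -> R) (D : pws R)
    (m : set 'rV[R]_2) (v1 v2 : R) (p : R -> 'rV[R]_2) (q : R -> R) :
  regular_param m v1 v2 p ->
  {within `[v1, v2], continuous q} ->
  {in `[v1, v2], forall v, q v != 0} ->
  {in `[v1, v2], forall v, sliding_field D (p v) = q v *: derive1 p v} ->
  {within `[v1, v2], continuous (divergence phi D \o p)} ->
  slow_divergence_integral phi D m
  = \int[lebesgue_measure]_(v in `[v1, v2]) (divergence phi D (p v) / `|q v|).
Proof.
move=> Hp cq q0 Xq cE; rewrite /slow_divergence_integral.
case: xgetP => [I _ [t1 [t2 [z [Hz ->]]]]|none].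
  exact: solution_integral Hp cq q0 Xq cE Hz.
have [t1 [t2 [z Hz]]] := exists_solution Hp cq q0 Xq.
by exfalso; apply: none; exists t1, t2, z; split; [exact: Hz|reflexivity].
Qed.

End TimeAlongSegment.

(** * Tangency of the sliding field *)

Section PlaneSystem.
Variable R : realType.
Implicit Types (D : pws R) (m : set 'rV[R]_2) (z : 'rV[R]_2).

Lemma continuous_gradient (A : set 'rV[R]_2) (f : 'rV[R]_2 -> R) i :
  smooth_on A f -> Ck 0 A (fun z => gradient f z 0 i).
Proof.
move=> sf; have [_ /(_ (delta_mx 0 i))] := sf 1%N.
rewrite (_ : 'D__ f = fun z => gradient f z 0 i)//.
by apply/funext => z; rewrite mxE.
Qed.

(** The sliding field is the combination of the two fields in which the Lie
    derivatives of the switching function cancel. *)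
Lemma dot_sliding_field D z :
  dot (gradient (swh D) z) (sliding_field D z) = 0.
Proof.
rewrite dotZr dotDr dotZr -scaleNr dotZr.
rewrite -[dot _ (fldm D z)]/(liem D z) -[dot _ (fldp D z)]/(liep D z).
by rewrite mulNr [liem D z * _]mulrC subrr mulr0.
Qed.

Lemma sliding_denom_neq0 D z : sliding_set D z -> liep D z - liem D z != 0.
Proof.
move=> [_ lt0]; apply: contraTN lt0; rewrite subr_eq0 => /eqP ->.
by rewrite -leNgt -expr2 sqr_ge0.
Qed.

Lemma tau_itv D z : sliding_set D z -> 0 < tau D z < 1.
Proof.
move=> Hz; have := sliding_denom_neq0 Hz; have [_] := Hz.
rewrite /tau; set a := liep D z; set b := liem D z => ab0 ab.
have [a0|a0|a0] := ltgtP a 0; last by move: ab0; rewrite a0 mul0r ltxx.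
  have b0 : 0 < b by rewrite nmulr_rlt0 in ab0.
  have n0 : 0 < b - a by lra.
  rewrite -[a - b]opprB invrN mulrNN divr_gt0//= ltr_pdivrMr// mul1r; lra.
have b0 : b < 0 by rewrite pmulr_rlt0 in ab0.
have n0 : 0 < a - b by lra.
by rewrite divr_gt0 ?oppr_gt0//= ltr_pdivrMr// mul1r; lra.
Qed.

(** The hypotheses on a family of systems, read at one value of the
    parameter. *)
Definition regular_pws D : Prop :=
  [/\ open (dom D), smooth_on (dom D) (swh D),
      (forall z, switching D z -> gradient (swh D) z != 0),
      smooth_in (closure (sidep D)) (fldp D)
    & smooth_in (closure (sidem D)) (fldm D)].

Lemma regular_pws_family l (Lam : set 'rV[R]_l) V h Zp Zm lam :
  pws_family Lam V h Zp Zm -> Lam lam -> regular_pws (pws_at V h Zp Zm lam).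
Proof.
move=> [oV sh g0 sp sm] Hlam; split=> /=.
- exact: oV.
- by apply: smooth_on_section sh.
- exact: g0.
- by apply: smooth_in_section sp => z /=.
- by apply: smooth_in_section sm => z /=.
Qed.

(** Moving from the switching boundary along the gradient, [swh D] becomes
    positive on one side and negative on the other. *)
Lemma switching_closure D z : regular_pws D -> switching D z ->
  closure (sidep D) z /\ closure (sidem D) z.
Proof.
move=> [oD sh g0 _ _] Hz; have [hz Dz] := Hz.
have dh := smooth_on_differentiable sh Dz.
set u := gradient (swh D) z.
have c0 : 0 < dot u u by apply: dot_gt0; exact: g0.
pose l (s : R) := s *: u + z.
have l0 : l 0 = z by rewrite /l scale0r add0r.
have dl : is_derive (0 : R) 1 l u.
  have -> : l = (fun s : R => s *: u) + cst z by [].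
  have dsu : differentiable (fun s : R => s *: u) 0.
    exact: ex_diff.
  have du : is_derive (0 : R) 1 (fun s : R => s *: u) u.
    apply: DeriveDef; first exact: diff_derivable.
    by rewrite deriveE// diff_val scale1r.
  by apply: is_derive_eq; rewrite addr0.
have dhl : is_derive (0 : R) 1 (swh D \o l) (dot u u).
  have Dl : differentiable l (0 : R) by apply/derivable1_diffP; case: dl.
  have dhl0 : differentiable (swh D) (l 0) by rewrite l0.
  have Dhl : differentiable (swh D \o l) (0 : R) by exact: differentiable_comp.
  apply: DeriveDef; first exact: diff_derivable.
  rewrite deriveE// diff_comp//= -(deriveE (1 : R) Dl).
  by have [_ ->] := dl; rewrite l0 dot_gradient.
have [k [kE ck k0]] := (is_derive1_caratheodory _ _ _).1 dhl.
have hl s : swh D (l s) = k s * s.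
  by have := kE s; rewrite /= l0 hz !subr0.
have kpos : \forall s \near (0 : R), 0 < k s.
  apply: (ck [set x | 0 < x]); apply: open_nbhs_nbhs.
  by split; [exact: open_gt|rewrite /= k0].
have cl : {for (0 : R), continuous l}.
  by apply: differentiable_continuous; apply/derivable1_diffP; case: dl.
have near_l (B : set 'rV[R]_2) : nbhs z B ->
    \forall s \near (0 : R), [/\ B (l s), dom D (l s) & 0 < k s].
  move=> nB; near=> s; split.
  - by near: s; apply: cl; rewrite l0.
  - by near: s; apply: cl; rewrite l0; exact: open_nbhs_nbhs.
  - by near: s.
split=> B /near_l nB.
- have [s s0 [Bl Dl ks]] :
      exists2 s : R, 0 < s & [/\ B (l s), dom D (l s) & 0 < k s].
    have nB' : \forall s \near 0^'+, [/\ B (l s), dom D (l s) & 0 < k s].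
      by apply: filterS nB.
    near (0 : R)^'+ => s; exists s => //; near: s; exact: nB'.
  by exists (l s); split=> //; split=> //; rewrite hl mulr_gt0.
- have [s s0 [Bl Dl ks]] :
      exists2 s : R, s < 0 & [/\ B (l s), dom D (l s) & 0 < k s].
    have nB' : \forall s \near 0^'-, [/\ B (l s), dom D (l s) & 0 < k s].
      by apply: filterS nB.
    near (0 : R)^'- => s; exists s => //; near: s; exact: nB'.
  by exists (l s); split=> //; split=> //; rewrite hl oppr_gt0 pmulr_rlt0.
Unshelve. all: by end_near. Qed.

Lemma tangent_segment D m v1 v2 p v : regular_pws D ->
  regular_param m v1 v2 p -> m `<=` switching D -> v \in `[v1, v2] ->
  dot (gradient (swh D) (p v)) (derive1 p v) = 0.
Proof.
move=> [_ sh _ _ _] Hp mD vI; have [v12 _ dp _ pim] := regular_paramP Hp.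
have pD u : u \in `[v1, v2] -> switching D (p u).
  by move=> uI; apply: mD; rewrite -pim; exists u.
have [_ Dp] := pD v vI; have dh := smooth_on_differentiable sh Dp.
apply: (@derive_eq0_segment R v1 v2 v _ (swh D \o p)) => //.
  by move=> u /pD[].
have Dpv : differentiable p v by apply/derivable1_diffP; case: (dp v vI).
have Dhp : differentiable (swh D \o p) v by exact: differentiable_comp.
apply: DeriveDef; first exact: diff_derivable.
by rewrite deriveE// diff_comp//= dot_gradient// derive1E deriveE.
Qed.

Lemma sliding_field_tangent D m v1 v2 p v : regular_pws D ->
  regular_param m v1 v2 p -> m `<=` sliding_set D -> v \in `[v1, v2] ->
  sliding_field D (p v)
  = (dot (sliding_field D (p v)) (derive1 p v)
     / dot (derive1 p v) (derive1 p v)) *: derive1 p v.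
Proof.
move=> HD Hp mD vI; have [_ _ _ p0 pim] := Hp.
have mp : m (p v) by rewrite -pim; exists v.
have [sw _] := mD _ mp; have [_ _ g0 _ _] := HD.
apply: (@collinear_orthogonal R (gradient (swh D) (p v))).
- exact: g0.
- exact: p0.
- exact: dot_sliding_field.
- by apply: (tangent_segment HD Hp) => // z /mD[].
Qed.

End PlaneSystem.

(** * Inverse of the regularizing function *)

Section RegularizingFunction.
Variable R : realType.
Variables (phi : R -> R) (Hphi : regularizing phi).

Lemma regularizing_continuous : continuous phi.
Proof.
by have [sphi _ _ _ _] := Hphi => x; exact: sphi 0%N x I.
Qed.

Lemma regularizing_derive1_continuous : continuous (derive1 phi).
Proof.
have [sphi _ _ _ _] := Hphi => x.
have -> : derive1 phi = 'D_1 phi by apply/funext => y; rewrite derive1E.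
exact: ((sphi 1%N).2 1) x I.
Qed.

Lemma regularizing_lt : {homo phi : x y / x < y}.
Proof.
move=> x y xy; have [sphi dphi _ _ _] := Hphi.
apply: (@gtr0_derive1_lt_cc _ phi x y) => //.
- by move=> u _; apply/derivable1_diffP; exact: (sphi 1%N).1 u I.
- by apply: continuous_subspaceT; exact: regularizing_continuous.
- by rewrite bound_itvE ltW.
- by rewrite bound_itvE ltW.
Qed.

Lemma regularizing_surj y : 0 < y < 1 -> exists x, phi x = y.
Proof.
move=> /andP[y0 y1]; have [_ _ [phi1 phi0] _ _] := Hphi.
have [b yb] := filter_ex (cvgr_gt 1 phi1 y y1).
have [a ay] := filter_ex (cvgr_lt 0 phi0 y y0).
have ab : a <= b.
  rewrite leNgt; apply/negP => /regularizing_lt ba.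
  by have := lt_trans (lt_trans ba ay) yb; rewrite ltxx.
have [||c _ <-] := @IVT _ phi a b y ab; last by exists c.
  by apply: continuous_subspaceT; exact: regularizing_continuous.
by rewrite ge_min le_max (ltW ay) (ltW yb) orbT.
Qed.

Lemma regularizing_inverse_continuous y :
  0 < y < 1 -> {for y, continuous (pinv setT phi)}.
Proof.
move=> /regularizing_surj[x <-]; set a := x - 1; set b := x + 1.
have ax : a < x by rewrite /a; lra.
have xb : x < b by rewrite /b; lra.
have phiI : injective phi.
  move=> u v; have [/regularizing_lt h|/regularizing_lt h|//] := ltgtP u v;
    by move=> e; rewrite e ltxx in h.
have phiK : {in `[a, b], cancel phi (pinv setT phi)}.
  move=> u _; apply: pinvKV; last by rewrite inE.
  by move=> ? ? _ _; exact: phiI.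
have cphi : {within `[a, b], continuous phi}.
  by apply: continuous_subspaceT; exact: regularizing_continuous.
have ab : a < b by exact: lt_trans xb.
have pab : phi a < phi b by exact: regularizing_lt.
have cg := segment_can_le_continuous (ltW ab) cphi phiK.
apply: (within_continuous_continuous pab cg).
by rewrite in_itv/= !regularizing_lt.
Qed.

End RegularizingFunction.

(** * Continuity along a sliding segment *)

Section SlidingContinuity.
Variable R : realType.
Implicit Types (D : pws R) (m : set 'rV[R]_2).

Lemma smooth_in_within_continuous (V W : normedModType R) (A B : set V)
    (f : V -> W) : B `<=` A -> smooth_in A f -> {within B, continuous f}.
Proof.
move=> BA [g [[U [oU AU sg]] fg]].
have cg : {within B, continuous g}.
  apply: continuous_in_subspaceT => x; rewrite inE => /BA/AU.
  exact: sg 0%N x.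
move: cg; apply: subspace_eq_continuous => x xB.
by change (g x = f x); rewrite fg// inE; apply: BA; rewrite inE in xB.
Qed.

Section AlongSlidingSet.
Variables (D : pws R) (m : set 'rV[R]_2).
Hypotheses (HD : regular_pws D) (mD : m `<=` sliding_set D).

Let gradient_cvg z : m z ->
  gradient (swh D) y @[y --> within m (nbhs z)] --> gradient (swh D) z.
Proof.
move=> mz; have [[_ Dz] _] := mD mz; have [_ sh _ _ _] := HD.
apply: cvg_within_filter; apply: cvg_row => i.
exact: continuous_gradient sh z Dz.
Qed.

Let fldp_cvg z : m z -> fldp D y @[y --> within m (nbhs z)] --> fldp D z.
Proof.
have [_ _ _ sp _] := HD; move: z.
apply/subspace_continuousP/(smooth_in_within_continuous _ sp) => z /mD[sw _].
exact: (switching_closure HD sw).1.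
Qed.

Let fldm_cvg z : m z -> fldm D y @[y --> within m (nbhs z)] --> fldm D z.
Proof.
have [_ _ _ _ sm] := HD; move: z.
apply/subspace_continuousP/(smooth_in_within_continuous _ sm) => z /mD[sw _].
exact: (switching_closure HD sw).2.
Qed.

Let liep_cvg z : m z -> liep D y @[y --> within m (nbhs z)] --> liep D z.
Proof. by move=> mz; apply: cvg_dot; [exact: gradient_cvg|exact: fldp_cvg]. Qed.

Let liem_cvg z : m z -> liem D y @[y --> within m (nbhs z)] --> liem D z.
Proof. by move=> mz; apply: cvg_dot; [exact: gradient_cvg|exact: fldm_cvg]. Qed.

Let denomV_cvg z : m z ->
  (liep D y - liem D y)^-1 @[y --> within m (nbhs z)]
    --> (liep D z - liem D z)^-1.
Proof.
move=> mz; apply: cvgV; first exact: sliding_denom_neq0 (mD mz).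
by apply: cvgB; [exact: liep_cvg|exact: liem_cvg].
Qed.

Lemma sliding_field_within_continuous :
  {within m, continuous (sliding_field D)}.
Proof.
apply/subspace_continuousP => z mz; apply: cvgZ; first exact: denomV_cvg.
by apply: cvgB; apply: cvgZ;
  [exact: liep_cvg|exact: fldm_cvg|exact: liem_cvg|exact: fldp_cvg].
Qed.

Lemma divergence_within_continuous (phi : R -> R) : regularizing phi ->
  {within m, continuous (divergence phi D)}.
Proof.
move=> Hphi; apply/subspace_continuousP => z mz; apply: cvgM.
  by apply: cvgB; [exact: liep_cvg|exact: liem_cvg].
have ct : tau D y @[y --> within m (nbhs z)] --> tau D z.
  by apply: cvgM; [apply: cvgN; exact: liem_cvg|exact: denomV_cvg].
have cu : pinv setT phi (tau D y) @[y --> within m (nbhs z)]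
    --> pinv setT phi (tau D z).
  apply: (cvg_comp _ _ ct).
  exact: regularizing_inverse_continuous (tau_itv (mD mz)).
apply: (cvg_comp _ _ cu); exact: regularizing_derive1_continuous.
Qed.

End AlongSlidingSet.

Lemma derive1_within_continuous m v1 v2 p : regular_param m v1 v2 p ->
  {within `[v1, v2], continuous (derive1 p)}.
Proof.
move=> [_ [U [oU IU sp]] _ _ _].
apply: continuous_in_subspaceT => v; rewrite inE => vI.
have -> : derive1 p = 'D_1 p by apply/funext => y; rewrite derive1E.
exact: ((sp 1%N).2 1) v (IU v vI).
Qed.

(** The speed [q] in [X = q *: p'] is the quotient of [X . p'] by [p' . p']. *)
Lemma speed_within_continuous m v1 v2 (p X : R -> 'rV[R]_2) (q : R -> R) :
  regular_param m v1 v2 p -> {within `[v1, v2], continuous X} ->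
  {in `[v1, v2], forall v, X v = q v *: derive1 p v} ->
  {within `[v1, v2], continuous q}.
Proof.
move=> Hp cX Xq; have [_ _ _ p0 _] := Hp.
have cp' := derive1_within_continuous Hp.
pose r v := dot (X v) (derive1 p v) / dot (derive1 p v) (derive1 p v).
have cr : {within `[v1, v2], continuous r}.
  apply/subspace_continuousP => v vI.
  have Xv := (subspace_continuousP _ _).1 cX v vI.
  have pv := (subspace_continuousP _ _).1 cp' v vI.
  apply: cvgM; first exact: cvg_dot.
  apply: cvgV; last exact: cvg_dot.
  by rewrite gt_eqF// dot_gt0// p0.
move: cr; apply: subspace_eq_continuous => v; rewrite inE => vI.
by change (r v = q v); rewrite /r Xq// dotZl mulfK// gt_eqF// dot_gt0// p0.
Qed.

Lemma speed_neq0 D m v1 v2 (p : R -> 'rV[R]_2) (q : R -> R) :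
  regular_param m v1 v2 p -> sliding_segment D m ->
  {in `[v1, v2], forall v, sliding_field D (p v) = q v *: derive1 p v} ->
  {in `[v1, v2], forall v, q v != 0}.
Proof.
move=> [_ _ _ _ pim] [_ mD m0] Xq v vI.
have mp : m (p v) by rewrite -pim; exists v.
apply/eqP => qv; apply: (m0 _ mp); split; first exact: mD.
by rewrite Xq// qv scale0r.
Qed.

Lemma exists_speed D m v1 v2 p :
  regular_pws D -> regular_param m v1 v2 p -> sliding_segment D m ->
  exists q : R -> R, [/\ {within `[v1, v2], continuous q},
    {in `[v1, v2], forall v, q v != 0},
    {in `[v1, v2], forall v, sliding_field D (p v) = q v *: derive1 p v}
    & {within `[v1, v2], continuous (sliding_field D \o p)}].
Proof.
move=> HD Hp Hm; have [_ mD _] := Hm; have [_ _ _ cp pim] := regular_paramP Hp.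
pose q v := dot (sliding_field D (p v)) (derive1 p v)
  / dot (derive1 p v) (derive1 p v).
have Xq : {in `[v1, v2], forall v, sliding_field D (p v) = q v *: derive1 p v}.
  by move=> v vI; exact: (sliding_field_tangent HD Hp mD vI).
have cX : {within `[v1, v2], continuous (sliding_field D \o p)}.
  apply: (continuous_comp_within _ cp (sliding_field_within_continuous HD mD)).
  by move=> v vI; rewrite -pim; exists v.
exists q; split=> //; first exact: speed_within_continuous Hp cX Xq.
exact: speed_neq0 Hp Hm Xq.
Qed.

Lemma divergence_param_continuous D m v1 v2 p phi :
  regular_pws D -> regularizing phi -> regular_param m v1 v2 p ->
  sliding_segment D m -> {within `[v1, v2], continuous (divergence phi D \o p)}.
Proof.
move=> HD Hphi Hp [_ mD _]; have [_ _ _ cp pim] := regular_paramP Hp.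
apply: (continuous_comp_within _ cp (divergence_within_continuous HD mD Hphi)).
by move=> v vI; rewrite -pim; exists v.
Qed.

Lemma slow_divergence_integral_param D m v1 v2 p q phi :
  regular_pws D -> regularizing phi -> sliding_segment D m ->
  regular_param m v1 v2 p ->
  {in `[v1, v2], forall v, sliding_field D (p v) = q v *: derive1 p v} ->
  slow_divergence_integral phi D m
  = \int[lebesgue_measure]_(v in `[v1, v2]) (divergence phi D (p v) / `|q v|).
Proof.
move=> HD Hphi Hm Hp Xq; have [q' [_ _ _ cX]] := exists_speed HD Hp Hm.
apply: slow_divergence_integralE => //.
- exact: speed_within_continuous Hp cX Xq.
- exact: speed_neq0 Hp Hm Xq.
- exact: divergence_param_continuous HD Hphi Hp Hm.
Qed.

End SlidingContinuity.

(** * Multiplication by a positive function *)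

Section Rescaling.
Variable R : realType.
Implicit Types (D : pws R) (m : set 'rV[R]_2).

Lemma lieZ (Z : 'rV[R]_2 -> 'rV[R]_2) (h g : 'rV[R]_2 -> R) z :
  lie (fun y => g y *: Z y) h z = g z * lie Z h z.
Proof. exact: dotZr. Qed.

Lemma sliding_field_rescale D N (g : 'rV[R]_2 -> R) z : g z != 0 ->
  sliding_field (rescale N g D) z = g z *: sliding_field D z.
Proof.
move=> g0; rewrite /sliding_field /liep /liem /= !lieZ -mulrBr invfM.
set a := lie _ _ _; set b := lie _ _ _; set M := fldm D z; set P := fldp D z.
have -> : (g z * a) *: (g z *: M) - (g z * b) *: (g z *: P)
    = (g z * g z) *: (a *: M - b *: P).
  by rewrite scalerBr !scalerA ![g z * _ * g z]mulrAC.
rewrite !scalerA; congr (_ *: _).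
by rewrite mulrACA mulVf// mul1r mulrC.
Qed.

Lemma tau_rescale D N (g : 'rV[R]_2 -> R) z : g z != 0 ->
  tau (rescale N g D) z = tau D z.
Proof.
move=> g0; rewrite /tau /liep /liem /= !lieZ -mulrBr -mulrN invfM mulrACA.
by rewrite divff// mul1r.
Qed.

Lemma divergence_rescale phi D N (g : 'rV[R]_2 -> R) z : g z != 0 ->
  divergence phi (rescale N g D) z = g z * divergence phi D z.
Proof.
move=> g0; rewrite /divergence tau_rescale// /liep /liem /= !lieZ -mulrBr.
by rewrite mulrA.
Qed.

Lemma sliding_segment_rescale D m N (g : 'rV[R]_2 -> R) : sliding_segment D m ->
  m `<=` N -> (forall z, N z -> 0 < g z) ->
  sliding_segment (rescale N g D) m.
Proof.
move=> [sm mD m0] mN g0.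
have mS : m `<=` sliding_set (rescale N g D).
  move=> z mz; have [[hz Dz] ll] := mD z mz; split.
    by split=> //; split=> //; exact: mN.
  rewrite /liep /liem /= !lieZ mulrACA pmulr_rlt0//.
  by rewrite mulr_gt0// g0//; exact: mN.
split=> // z mz [_]; have gz : g z != 0 by rewrite gt_eqF// g0//; exact: mN.
rewrite sliding_field_rescale// => /eqP; rewrite scaler_eq0 (negPf gz)/=.
by move=> /eqP Xz; apply: (m0 z mz); split=> //; exact: mD.
Qed.

(** The factor [g] appears in the divergence and in the speed, and cancels in
    their quotient. *)
Theorem slow_divergence_integral_rescale phi D m N (g : 'rV[R]_2 -> R) :
  regular_pws D -> regularizing phi -> sliding_segment D m ->
  m `<=` N -> smooth_on N g -> (forall z, N z -> 0 < g z) ->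
  slow_divergence_integral phi D m
  = slow_divergence_integral phi (rescale N g D) m.
Proof.
move=> HD Hphi Hm mN sg g0; have [[v1 [v2 [p Hp]]] _ _] := Hm.
have [q [cq q0 Xq cX]] := exists_speed HD Hp Hm.
have [_ _ _ cp pim] := regular_paramP Hp.
have Np v : v \in `[v1, v2] -> N (p v).
  by move=> vI; apply: mN; rewrite -pim; exists v.
have gp v : v \in `[v1, v2] -> g (p v) != 0.
  by move=> /Np/g0; rewrite lt0r => /andP[].
have cg : {within `[v1, v2], continuous (g \o p)}.
  apply: (continuous_comp_within (B := N) _ cp) => [v /Np//|].
  by apply: continuous_in_subspaceT => z; rewrite inE => Nz; exact: sg 0%N z Nz.
have cE := divergence_param_continuous HD Hphi Hp Hm.
have cM (a b : R -> R) : {within `[v1, v2], continuous a} ->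
    {within `[v1, v2], continuous b} -> {within `[v1, v2], continuous (a \* b)}.
  move=> ca cb; apply/subspace_continuousP => v vI; apply: cvgM.
    exact: (subspace_continuousP _ _).1 ca v vI.
  exact: (subspace_continuousP _ _).1 cb v vI.
rewrite (slow_divergence_integralE Hp cq q0 Xq cE).
rewrite (@slow_divergence_integralE _ _ _ _ v1 v2 p ((g \o p) \* q)).
- apply: eq_Rintegral => v; rewrite inE => vI /=.
  rewrite divergence_rescale ?gp// normrM (gtr0_norm (g0 _ (Np v vI))).
  by rewrite invfM mulrACA divff ?mul1r ?gp.
- exact: Hp.
- exact: cM.
- by move=> v vI /=; rewrite mulf_neq0 ?gp ?q0.
- by move=> v vI /=; rewrite sliding_field_rescale ?gp// Xq// scalerA.
- move: (cM _ _ cg cE); apply: subspace_eq_continuous => v; rewrite inE => vI.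
  change (g (p v) * divergence phi D (p v)
          = divergence phi (rescale N g D) (p v)).
  by rewrite divergence_rescale ?gp.
Qed.

End Rescaling.

(** * Change of coordinates *)

Section Pullback.
Variable R : realType.
Variables (D : pws R) (m Vw Vz : set 'rV[R]_2) (T S : 'rV[R]_2 -> 'rV[R]_2).
Hypotheses (HD : regular_pws D) (oVw : open Vw) (oVz : open Vz)
  (TVw : set_bij Vw Vz T) (sT : smooth_on Vw T) (sS : smooth_on Vz S)
  (TK : {in Vw, cancel T S}) (VzD : Vz `<=` dom D).

Let T_Vz w : Vw w -> Vz (T w).
Proof. by move=> Vww; have [+ _ _] := TVw; apply. Qed.

Let SP z : Vz z -> Vw (S z) /\ T (S z) = z.
Proof.
move=> Vzz; have [_ _ surj] := TVw; have [w Vww <-] := surj z Vzz.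
by rewrite TK ?inE.
Qed.

Let dT w : Vw w -> differentiable T w.
Proof. exact: smooth_on_differentiable. Qed.

Let jacobian_unit w : Vw w -> 'J T w \in unitmx.
Proof.
move=> Vww; have dS := smooth_on_differentiable sS (T_Vz Vww).
apply: (jacobian_inverse (dT Vww) dS).
by apply: filterS (open_nbhs_nbhs (conj oVw Vww)) => y Vwy; rewrite TK ?inE.
Qed.

(** The differential of [swh D \o T] and the inverse differential in the
    pulled back field cancel by the chain rule. *)
Let lie_pullback (Z : 'rV[R]_2 -> 'rV[R]_2) w : Vw w ->
  lie (pullback_field T Z) (swh D \o T) w = lie Z (swh D) (T w).
Proof.
move=> Vww; have [_ sh _ _ _] := HD.
have dh := smooth_on_differentiable sh (VzD (T_Vz Vww)).
have dhT := differentiable_comp (dT Vww) dh.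
apply: etrans (dot_gradient _ dhT) _.
apply: etrans (diff_compE _ (dT Vww) dh) _.
apply: etrans (esym (dot_gradient _ dh)).
congr ('d (swh D) (T w) _); rewrite -mul_jacobian /pullback_field.
exact: mulmxKV (jacobian_unit Vww) _.
Qed.

Let liep_pullback w : Vw w -> liep (pullback Vw T D) w = liep D (T w).
Proof. exact: lie_pullback. Qed.

Let liem_pullback w : Vw w -> liem (pullback Vw T D) w = liem D (T w).
Proof. exact: lie_pullback. Qed.

Let sliding_field_pullback w : Vw w ->
  sliding_field (pullback Vw T D) w = sliding_field D (T w) *m invmx ('J T w).
Proof.
move=> Vww; rewrite /sliding_field liep_pullback// liem_pullback//=.
by rewrite -scalemxAl mulmxBl -!scalemxAl.
Qed.

Let divergence_pullback phi w : Vw w ->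
  divergence phi (pullback Vw T D) w = divergence phi D (T w).
Proof.
by move=> Vww; rewrite /divergence /tau liep_pullback// liem_pullback.
Qed.

Hypothesis mVz : m `<=` Vz.

Let regular_param_pullback v1 v2 (p : R -> 'rV[R]_2) :
  regular_param m v1 v2 p ->
  regular_param (Vw `&` T @^-1` m) v1 v2 (S \o p) /\
  {in `[v1, v2], forall v,
    derive1 p v = derive1 (S \o p) v *m 'J T (S (p v))}.
Proof.
move=> Hp; have [v12 pinj dp cp pim] := regular_paramP Hp.
have [_ [U [oU IU sp]] _ p0 _] := Hp.
have mp v : v \in `[v1, v2] -> m (p v) by move=> vI; rewrite -pim; exists v.
have Vzp v : v \in `[v1, v2] -> Vz (p v) by move=> /mp/mVz.
pose U' := U `&` p @^-1` Vz.
have oU' : open U' by apply: open_preimage => // x; exact: sp 0%N x.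
have IU' v : v \in `[v1, v2] -> U' v by move=> vI; split; [exact: IU|exact: Vzp].
have sSp : smooth_on U' (S \o p).
  move=> k; apply: (Ck_comp (frame_row R 2) oU' (B := Vz)) => [x []//||].
    by apply: sub_Ck (sp k) => x [].
  exact: sS.
have dSp v : v \in `[v1, v2] ->
    derive1 p v = derive1 (S \o p) v *m 'J T (S (p v)).
  move=> vI; have U'v := IU' v vI.
  have Dw := smooth_on_differentiable sSp U'v.
  have [Vww TSp] := SP (Vzp v vI).
  have DT := dT Vww.
  have near_p : \forall y \near v, (T \o (S \o p)) y = p y.
    apply: filterS (open_nbhs_nbhs (conj oU' U'v)) => y [_ Vzy] /=.
    by have [_ ->] := SP Vzy.
  rewrite derive1E -(near_eq_derive (1 : R) near_p).
  apply: etrans (derive_compE _ Dw DT) _.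
  by rewrite mul_jacobian derive1E.
split; last exact: dSp.
split.
- exact: v12.
- by exists U'; split.
- move=> x y xI yI /= Sxy; apply: (pinj _ _ xI yI).
  by rewrite -(SP (Vzp x xI)).2 -(SP (Vzp y yI)).2 Sxy.
- move=> v vI; apply: contra (p0 v vI) => /eqP h.
  by rewrite dSp// h mul0mx.
- apply/seteqP; split=> [_ [v vI <-]|w [Vww mw]].
    by have [? Tp] := SP (Vzp v vI); split=> //=; rewrite Tp; exact: mp.
  have := mw; rewrite /= -pim => -[v vI pv]; exists v => //=.
  by rewrite pv TK ?inE.
Qed.

Lemma sliding_segment_pullback : sliding_segment D m ->
  sliding_segment (pullback Vw T D) (Vw `&` T @^-1` m).
Proof.
move=> [[v1 [v2 [p Hp]]] mD m0]; have [Hw _] := regular_param_pullback Hp.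
split.
- by exists v1, v2, (S \o p).
- move=> w [Vww /= mw]; have [[hz _] ll] := mD _ mw; split; first by split.
  by rewrite liep_pullback// liem_pullback.
- move=> w [Vww /= mw] [_ Xw]; apply: (m0 _ mw); split; first exact: mD.
  rewrite -[LHS](mulmxKV (jacobian_unit Vww)) -sliding_field_pullback//.
  by rewrite Xw mul0mx.
Qed.

(** The velocity of [S \o p] is transformed by the inverse differential of [T]
    just as the sliding field, so that both parameterizations have the same speed
    [q]. *)
Theorem slow_divergence_integral_pullback phi : regularizing phi ->
  sliding_segment D m ->
  slow_divergence_integral phi (pullback Vw T D) (Vw `&` T @^-1` m)
  = slow_divergence_integral phi D m.
Proof.
move=> Hphi Hm; have [[v1 [v2 [p Hp]]] _ _] := Hm.
have [Hw dSp] := regular_param_pullback Hp.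
have [q [cq q0 Xq cX]] := exists_speed HD Hp Hm.
have [_ _ _ cp pim] := regular_paramP Hp.
have cE := divergence_param_continuous HD Hphi Hp Hm.
have SPp v : v \in `[v1, v2] -> Vw (S (p v)) /\ T (S (p v)) = p v.
  by move=> vI; apply: SP; apply: mVz; rewrite -pim; exists v.
rewrite (slow_divergence_integralE Hp cq q0 Xq cE).
rewrite (slow_divergence_integralE Hw cq q0).
- apply: eq_Rintegral => v; rewrite inE => vI /=.
  by have [Vwv Tv] := SPp v vI; rewrite divergence_pullback// Tv.
- move=> v vI /=; have [Vwv Tv] := SPp v vI.
  rewrite sliding_field_pullback// Tv Xq// dSp// scalemxAl.
  exact: (mulmxK (jacobian_unit Vwv) _).
- move: cE; apply: subspace_eq_continuous => v; rewrite inE => vI.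
  change (divergence phi D (p v) = divergence phi (pullback Vw T D) (S (p v))).
  by have [Vwv Tv] := SPp v vI; rewrite divergence_pullback// Tv.
Qed.

End Pullback.

(** * Smooth dependence of the speed on the parameter *)

Section SpeedFamily.
Variable R : realType.

Lemma exists_speed_family l (Lam : set 'rV[R]_l) V h Zp Zm
    (m : 'rV[R]_l -> set 'rV[R]_2) (v1 v2 : R) (p : 'rV[R]_l -> R -> 'rV[R]_2) :
  let D := pws_at V h Zp Zm in
  open Lam -> pws_family Lam V h Zp Zm ->
  (forall lam, Lam lam -> sliding_segment (D lam) (m lam)) ->
  smooth_near (Lam `*` `[v1, v2]) (uncurried p) ->
  (forall lam, Lam lam -> regular_param (m lam) v1 v2 (p lam)) ->
  exists q, speed_family Lam D v1 v2 p q.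
Proof.
move=> D oLam HF Hm [U [oU IU sp]] Hp.
have [oV sh g0 sZp sZm] := HF.
have [Gp [[Up [oUp IUp sGp]] EGp]] := sZp.
have [Gm [[Um [oUm IUm sGm]] EGm]] := sZm.
(* On [A2] all ingredients of the quotient are smooth; on [A3] its denominators
   do not vanish either. *)
pose A := U `&` fst @^-1` Lam.
have oA : open A.
  by apply: (open_preimage oU oLam) => x _; exact: cvg_fst.
have sPhi k : Ck k A (fun x : 'rV[R]_l * R => (x.1, uncurried p x)).
  apply: (Ck_pair oA); last by apply: sub_Ck (sp k) => x [].
  have cf : continuous (fst : 'rV[R]_l * R -> 'rV[R]_l).
    by move=> x; exact: cvg_fst.
  exact: (Ck_linear_comp (L := fst) oA cf (Ck_id k oA)).
pose Phi (x : 'rV[R]_l * R) := (x.1, uncurried p x).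
pose B := (Lam `*` V) `&` (Up `&` Um).
have oB : open B.
  apply: openI; last exact: openI.
  have -> : Lam `*` V = (setT `&` fst @^-1` Lam) `&` snd @^-1` V.
    by apply/seteqP; split=> [x []|x [[_]]].
  apply: open_preimage oV _ => [|x _]; last exact: cvg_snd.
  by apply: (open_preimage openT oLam) => x _; exact: cvg_fst.
pose A2 := A `&` Phi @^-1` B.
have oA2 : open A2 by apply: (open_preimage oA oB) => x; exact: sPhi 0%N x.
have comp2 (W : normedModType R) k (f : 'rV[R]_l * 'rV[R]_2 -> W) :
    Ck k B f -> Ck k A2 (f \o Phi).
  apply: (Ck_compose_prod oA2) => [x []//|].
  by apply: sub_Ck (sPhi k) => x [].
pose gr i x := 'D_(0, delta_mx 0 i) (uncurried h) (Phi x).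
pose zp i x := Gp (Phi x) 0 i.
pose zm i x := Gm (Phi x) 0 i.
pose dp i x := 'D_(0, 1) (uncurried p) x 0 i.
have sgr k i : Ck k A2 (gr i).
  apply: (comp2 _ k ('D_(0, delta_mx 0 i) (uncurried h))).
  by apply: sub_Ck ((sh k.+1).2 _) => x [].
have szp k i : Ck k A2 (zp i).
  apply: (@Ck_coord R _ _ k A2 (Gp \o Phi) i oA2).
  by apply: comp2; apply: sub_Ck (sGp k) => x [_ []].
have szm k i : Ck k A2 (zm i).
  apply: (@Ck_coord R _ _ k A2 (Gm \o Phi) i oA2).
  by apply: comp2; apply: sub_Ck (sGm k) => x [_ []].
have sdp k i : Ck k A2 (dp i).
  apply: (@Ck_coord R _ _ k A2 ('D_(0, 1) (uncurried p)) i oA2).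
  by apply: sub_Ck ((sp k.+1).2 _) => x [[]].
pose lp x := \sum_i gr i x * zp i x.
pose lm x := \sum_i gr i x * zm i x.
pose dn x := lp x - lm x.
pose pp x := \sum_i dp i x * dp i x.
pose nu x := \sum_i (lp x * zm i x - lm x * zp i x) * dp i x.
have slp k : Ck k A2 lp.
  by apply: (Ck_sum _ oA2) => i; exact: (CkZ oA2 (sgr k i) (szp k i)).
have slm k : Ck k A2 lm.
  by apply: (Ck_sum _ oA2) => i; exact: (CkZ oA2 (sgr k i) (szm k i)).
have spp k : Ck k A2 pp.
  by apply: (Ck_sum _ oA2) => i; exact: (CkZ oA2 (sdp k i) (sdp k i)).
have CkB k f1 f2 : Ck k A2 f1 -> Ck k A2 f2 ->
    Ck k A2 (fun x => f1 x - f2 x : R).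
  move=> s1 s2; have s2' := CkZ oA2 (Ck_cst k A2 (-1 : R)) s2.
  by apply: (eq_Ck oA2 _ (CkD oA2 s1 s2')) => x _ /=; rewrite scaleN1r.
have sdn k : Ck k A2 dn by exact: (CkB _ _ _ (slp k) (slm k)).
have snu k : Ck k A2 nu.
  apply: (Ck_sum _ oA2) => i; apply: (CkZ oA2 _ (sdp k i)).
  apply: CkB; [exact: (CkZ oA2 (slp k) (szm k i))|].
  exact: (CkZ oA2 (slm k) (szp k i)).
pose A3 := A2 `&` (fun x => dn x * pp x) @^-1` [set u | u != 0].
have sdp' k : Ck k A2 (fun x => dn x * pp x).
  exact: (CkZ oA2 (sdn k) (spp k)).
have oA3 : open A3.
  by apply: (open_preimage oA2 (@open_neq R 0)) => x; exact: sdp' 0%N x.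
pose q lam v := nu (lam, v) / (dn (lam, v) * pp (lam, v)).
have sq : smooth_on A3 (uncurried q).
  move=> k; have A32 : A3 `<=` A2 by move=> x [].
  have s1 : Ck k A3 (fun x => (dn x * pp x)^-1).
    by apply: (CkV oA3) => [x []//|]; exact: sub_Ck A32 (sdp' k).
  have s2 : Ck k A3 nu by exact: sub_Ck A32 (snu k).
  by apply: (eq_Ck oA3 _ (CkZ oA3 s2 s1)) => -[lam v] _.
have inA lam v : Lam lam -> v \in `[v1, v2] -> A3 (lam, v) /\
    q lam v = dot (sliding_field (D lam) (p lam v)) (derive1 (p lam) v)
      / dot (derive1 (p lam) v) (derive1 (p lam) v).
  move=> Hl vI; have [_ mD _] := Hm _ Hl; have [_ _ _ p0 pim] := Hp _ Hl.
  have HD := regular_pws_family HF Hl.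
  have mpv : m lam (p lam v) by rewrite -pim; exists v.
  have Sl := mD _ mpv; have [sw _] := Sl.
  have [clp clm] := switching_closure HD sw.
  have Uv : U (lam, v) by apply: IU.
  have A2v : A2 (lam, v).
    split; first by split.
    split; first by split=> //; case: sw.
    by split; [exact: IUp|exact: IUm].
  have grE i : gr i (lam, v) = gradient (swh (D lam)) (p lam v) 0 i.
    by rewrite mxE /gr /Phi /= -derive_section.
  have zpE i : zp i (lam, v) = fldp (D lam) (p lam v) 0 i.
    by rewrite /zp -EGp//; exact: mem_set.
  have zmE i : zm i (lam, v) = fldm (D lam) (p lam v) 0 i.
    by rewrite /zm -EGm//; exact: mem_set.
  have dpE i : dp i (lam, v) = derive1 (p lam) v 0 i.
    by rewrite /dp derive_section derive1E.
  have lpE : lp (lam, v) = liep (D lam) (p lam v).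
    by apply: eq_bigr => i _; rewrite grE zpE.
  have lmE : lm (lam, v) = liem (D lam) (p lam v).
    by apply: eq_bigr => i _; rewrite grE zmE.
  have ppE : pp (lam, v) = dot (derive1 (p lam) v) (derive1 (p lam) v).
    by apply: eq_bigr => i _; rewrite dpE.
  have dn0 : dn (lam, v) != 0 by rewrite /dn lpE lmE sliding_denom_neq0.
  have pp0 : pp (lam, v) != 0.
    by rewrite ppE; exact: lt0r_neq0 (dot_gt0 (p0 v vI)).
  split; first by split; [exact: A2v|exact: mulf_neq0].
  rewrite /q -ppE invfM mulrA; congr (_ / _).
  rewrite dotZl /dn lpE lmE mulrC; congr (_ * _).
  by apply: eq_bigr => i _; rewrite lpE lmE zpE zmE dpE !mxE.
exists q; split.
  exists (uncurried q); split=> //; exists A3; split=> //.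
  by move=> [lam v] [/= Hl vI]; exact: (inA lam v Hl vI).1.
move=> lam v Hl vI; have HD := regular_pws_family HF Hl.
have Xq : {in `[v1, v2], forall v, sliding_field (D lam) (p lam v)
    = q lam v *: derive1 (p lam) v}.
  move=> u uI; rewrite (inA lam u Hl uI).2.
  have [_ mD _] := Hm _ Hl.
  exact: (sliding_field_tangent HD (Hp _ Hl) mD uI).
split; last exact: Xq.
exact: (speed_neq0 (Hp _ Hl) (Hm _ Hl) Xq vI).
Qed.

End SpeedFamily.

Theorem theorem2p2 (R : realType) (l : nat) (lam0 : 'rV[R]_l)
    (Lam : set 'rV[R]_l) (V : set 'rV[R]_2)
    (h : 'rV[R]_l -> 'rV[R]_2 -> R)
    (Zp Zm : 'rV[R]_l -> 'rV[R]_2 -> 'rV[R]_2)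
    (phi : R -> R) (m : 'rV[R]_l -> set 'rV[R]_2) :
  let D := pws_at V h Zp Zm in
  open_nbhs lam0 Lam ->
  pws_family Lam V h Zp Zm ->
  regularizing phi ->
  (forall lam, Lam lam -> sliding_segment (D lam) (m lam)) ->
  [/\ (forall (lam : 'rV[R]_l) (Vw Vz : set 'rV[R]_2)
         (T : 'rV[R]_2 -> 'rV[R]_2),
         Lam lam -> coordinate_change Vw Vz T -> Vz `<=` V -> m lam `<=` Vz ->
         sliding_segment (pullback Vw T (D lam)) (Vw `&` T @^-1` m lam) /\
         slow_divergence_integral phi (pullback Vw T (D lam))
           (Vw `&` T @^-1` m lam)
         = slow_divergence_integral phi (D lam) (m lam)),
      (forall (lam : 'rV[R]_l) (N : set 'rV[R]_2) (g : 'rV[R]_2 -> R),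
         Lam lam -> open N -> m lam `<=` N -> smooth_on N g ->
         (forall z, N z -> 0 < g z) ->
         sliding_segment (rescale N g (D lam)) (m lam) /\
         slow_divergence_integral phi (D lam) (m lam)
         = slow_divergence_integral phi (rescale N g (D lam)) (m lam))
    & (forall (v1 v2 : R) (p : 'rV[R]_l -> R -> 'rV[R]_2),
         smooth_near (Lam `*` `[v1, v2]) (uncurried p) ->
         (forall lam, Lam lam -> regular_param (m lam) v1 v2 (p lam)) ->
         (exists q, speed_family Lam D v1 v2 p q) /\
         (forall q, speed_family Lam D v1 v2 p q ->
            forall lam, Lam lam ->
            slow_divergence_integral phi (D lam) (m lam)
            = \int[lebesgue_measure]_(v in `[v1, v2])
                (divergence phi (D lam) (p lam v) / `|q lam v|)))].
Proof.
move=> D [oLam _] HF Hphi Hm; split.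
- move=> lam Vw Vz T Hl [oVw oVz TV sT [S [sS TK]]] VzV mVz.
  have HD := regular_pws_family HF Hl.
  split.
    exact: (sliding_segment_pullback HD oVw oVz TV sT sS TK VzV mVz (Hm _ Hl)).
  exact: (slow_divergence_integral_pullback HD oVw oVz TV sT sS TK VzV mVz Hphi
    (Hm _ Hl)).
- move=> lam N g Hl oN mN sg g0; have HD := regular_pws_family HF Hl.
  split; first exact: sliding_segment_rescale (Hm _ Hl) mN g0.
  exact: slow_divergence_integral_rescale HD Hphi (Hm _ Hl) mN sg g0.
- move=> v1 v2 p sp Hp; split; first exact: exists_speed_family Hm sp Hp.
  move=> q [_ Hq] lam Hl; have HD := regular_pws_family HF Hl.
  apply: (slow_divergence_integral_param HD Hphi (Hm _ Hl) (Hp _ Hl)).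
  by move=> v vI; exact: (Hq lam v Hl vI).2.
Qed.
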